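(* Let $T>0$, let $u(\cdot)=(u_1(\cdot),\ldots,u_m(\cdot))$ with $u_i:[0,T]\to\mathbb{R}^n$ and $b(\cdot)=(b_1(\cdot),\ldots,b_m(\cdot))$ with $b_i:[0,T]\to\mathbb{R}$ be absolutely continuous on $[0,T]$, and put $$C(t):=\{x\in\mathbb{R}^n\mid \langle u_i(t),x\rangle\le b_i(t),\ i=1,\ldots,m\},\quad t\in[0,T].$$ Assume that $C(t)\neq\emptyset$ for all $t\in[0,T]$ and that for every $t\in[0,T]$ and every $x\in C(t)$ the vectors $\{u_i(t)\mid i\in I_x(t)\}$ are linearly independent, where $I_x(t):=\{i\in\{1,\ldots,m\}\mid\langle u_i(t),x\rangle=b_i(t)\}$. Let $x_0\in C(0)$. Then the Cauchy problem $$\dot x(t)\in -N(x(t);C(t))\ \text{ for a.e. } t\in[0,T],\qquad x(0)=x_0,$$ admits a unique absolutely continuous solution $x(\cdot)$ on $[0,T]$.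
   Context: For a convex set $C\subset\mathbb{R}^n$, the normal cone is $N(x;C):=\{v\in\mathbb{R}^n\mid\langle v,y-x\rangle\le 0\ \text{for all } y\in C\}$ if $x\in C$ and $N(x;C):=\emptyset$ if $x\notin C$ (so a solution of the inclusion satisfies $x(t)\in C(t)$). *)

(* Defs.v *)
From HB Require Import structures.
From mathcomp Require Import all_boot all_order all_algebra.
From mathcomp Require Import all_classical all_reals all_analysis.

Set Implicit Arguments.
Unset Strict Implicit.
Unset Printing Implicit Defensive.

Import Order.TTheory GRing.Theory Num.Theory.
Import numFieldNormedType.Exports.

Local Open Scope classical_set_scope.
Local Open Scope ring_scope.

Definition dot (R : realType) (n : nat) (x y : 'rV[R]_n) : R :=
  \sum_(j < n) x ord0 j * y ord0 j.

(* The norm of V = 'rV[R]_n is the sup norm; the notion does not depend on the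
   choice of a norm on R^n. Degenerate intervals are harmless. *)
Definition abs_continuous (R : realType) (V : normedModType R)
    (a b : R) (f : R -> V) : Prop :=
  forall e : R, 0 < e -> exists2 d : R, 0 < d &
    forall (k : nat) (I : 'I_k -> R * R),
      (forall i, a <= (I i).1 /\ (I i).1 <= (I i).2 /\ (I i).2 <= b) ->
      trivIset [set: 'I_k] (fun i => `](I i).1, (I i).2[%classic) ->
      \sum_(i < k) ((I i).2 - (I i).1) < d ->
      \sum_(i < k) `|f (I i).2 - f (I i).1| < e.

Definition normal_cone (R : realType) (n : nat) (C : set 'rV[R]_n)
    (x : 'rV[R]_n) : set 'rV[R]_n :=
  [set v | C x /\ forall y, C y -> dot v (y - x) <= 0].

Definition polyhedron (R : realType) (n m : nat)
    (u : 'I_m -> R -> 'rV[R]_n) (b : 'I_m -> R -> R) (t : R) : set 'rV[R]_n :=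
  [set x | forall i, dot (u i t) x <= b i t].

Definition active (R : realType) (n m : nat)
    (u : 'I_m -> R -> 'rV[R]_n) (b : 'I_m -> R -> R) (t : R) (x : 'rV[R]_n) :
    {set 'I_m} :=
  [set i | dot (u i t) x == b i t]%SET.

(* Only the values of x on [0, T] matter: the two-sided derivative at the
   endpoints is irrelevant, since {0, T} is a null set. *)
Definition sweeping_solution (R : realType) (n : nat) (T : R)
    (C : R -> set 'rV[R]_n) (x0 : 'rV[R]_n) (x : R -> 'rV[R]_n) : Prop :=
  [/\ abs_continuous 0 T x,
      {ae @lebesgue_measure R, forall t, t \in `[0, T] ->
         derivable x t 1 /\
         [set - v | v in normal_cone (C t) (x t)] (derive1 x t)} &
      x 0 = x0].

(* Main.v *)
Require Import Defs.
From HB Require Import structures.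
From mathcomp Require Import all_boot all_order all_algebra.
From mathcomp Require Import all_classical all_reals all_analysis.
From mathcomp Require Import measurable_realfun ring lra.

(** Linear independence of the active normals makes every C(t) have a point at
    which all constraints are strict; near t such a point stays uniformly
    strict, so a point of C(s) is within K (v t - v s) of C(t), where v is the
    total variation of the data, an absolutely continuous nondecreasing
    function.  Locally, Moreau's catching-up scheme (project the current point
    on the next C(t_k)) therefore has increments dominated by those of v, and
    the distance of its iterates to any point common to all the C(t_k) does not
    increase.  Both properties pass to a pointwise limit along an ultrafilter
    of step sizes and to concatenations, which yields a curve on [0, T]; where
    it is differentiable, the monotonicity of the distances to the strictly
    feasible points says that minus its derivative is a normal vector.
    Absolutely continuous functions are differentiable almost everywhere and
    are nonincreasing when their derivative is almost everywhere nonpositive,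
    because the Lebesgue-Stieltjes measure of a nondecreasing absolutely
    continuous function has a density by Radon-Nikodym.  Applied to the squared
    distance of two solutions this gives uniqueness, normal cones being
    monotone. *)

Set Implicit Arguments.
Unset Strict Implicit.
Unset Printing Implicit Defensive.

Import Order.TTheory GRing.Theory Num.Theory.
Import numFieldNormedType.Exports.

Local Open Scope classical_set_scope.
Local Open Scope ring_scope.

(** * Absolute continuity on the line *)

Section ac.
Context {R : realType}.
Implicit Types (V : normedModType R) (s : seq (R * R)).

(* Disjointness of the open intervals ]p.1, p.2[ and ]q.1, q.2[. *)
Definition nonoverlap (p q : R * R) : bool :=
  [|| p.2 <= p.1, q.2 <= q.1, p.2 <= q.1 | q.2 <= p.1].

(* Finite families are lists here, so that refining an interval into pieces is
   list concatenation. *)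
Definition ac_line V (f : R -> V) : Prop :=
  forall e : R, 0 < e -> exists2 d : R, 0 < d & forall s,
    all (fun p => p.1 <= p.2) s -> pairwise nonoverlap s ->
    \sum_(p <- s) (p.2 - p.1) < d ->
    \sum_(p <- s) `|f p.2 - f p.1| < e.

(* Composing with [clip a b] extends a function on [a, b] to the whole line by
   constants, which avoids all boundary cases below. *)
Definition clip (a b t : R) : R := Num.max a (Num.min t b).

Lemma clip_ge (a b t : R) : a <= clip a b t.
Proof. by rewrite /clip le_max lexx. Qed.

Lemma clip_le (a b t : R) : a <= b -> clip a b t <= b.
Proof. by move=> ab; rewrite /clip ge_max ab ge_min lexx orbT. Qed.

Lemma clip_id (a b t : R) : a <= t <= b -> clip a b t = t.
Proof. by move=> /andP[a_t tb]; rewrite /clip (min_idPl tb) (max_idPr a_t). Qed.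

Lemma le_clip (a b : R) : {homo clip a b : s t / s <= t}.
Proof.
move=> s t st; rewrite /clip; have [?|?] := leP s b; have [?|?] := leP t b;
  rewrite ge_max !le_max ?lexx /=; lra.
Qed.

Lemma clip_lip (a b s t : R) : a <= b -> s <= t ->
  clip a b t - clip a b s <= t - s.
Proof.
move=> ab st; rewrite /clip; have [?|?] := leP s b; have [?|?] := leP t b.
- by have [?|?] := leP a s; have [?|?] := leP a t; lra.
- by have [?|?] := leP a s; have [?|?] := leP a b; lra.
- by have [?|?] := leP a b; have [?|?] := leP a t; lra.
- by have [?|?] := leP a b; lra.
Qed.

(** [clip a b] is nondecreasing and 1-Lipschitz, so it carries a nonoverlapping family to one inside
    [[a, b]] whose total length is no larger. *)
Lemma abs_continuous_clip V (a b : R) (f : R -> V) : a <= b ->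
  abs_continuous a b f -> ac_line (f \o clip a b).
Proof.
move=> ab acf e e0; have [d d0 H] := acf e e0; exists d => // s sle sno sd.
pose I (i : 'I_(size s)) := (clip a b (nth (0, 0) s i).1,
                             clip a b (nth (0, 0) s i).2).
have := H (size s) I; rewrite /= (big_nth (0, 0)) big_mkord; apply.
- move=> i; rewrite /I/= clip_ge clip_le//; split=> //; split=> //.
  by apply: le_clip; move/all_nthP : sle; exact.
- move=> i j _ _ [x []] /=; rewrite !in_itv/=.
  wlog ij : i j / (i < j)%N.
    move=> W xi xj; have [|ji|ij] := ltngtP i j; first by move/W; apply.
      by apply/esym; exact: W.
    exact/val_inj.
  move=> /andP[x1 x2] /andP[x3 x4]; exfalso.
  have : nonoverlap (nth (0, 0) s i) (nth (0, 0) s j).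
    by move/(pairwiseP (0, 0)) : sno; apply; rewrite ?inE.
  (* Each of the four alternatives of [nonoverlap] contradicts the monotonicity of [clip] once the
     clipped intervals share a point. *)
  have C u v w : clip a b u < w -> w < clip a b v -> v <= u -> False.
    by move=> A B vu; have := lt_trans A B; rewrite ltNge le_clip.
  by move=> /or4P[]; [exact: (C _ _ _ x1 x2)|exact: (C _ _ _ x3 x4)|
    exact: (C _ _ _ x3 x2)|exact: (C _ _ _ x1 x4)].
- apply: le_lt_trans sd; rewrite (big_nth (0, 0)) big_mkord.
  apply: ler_sum => i _; rewrite /= clip_lip//.
  by move/all_nthP : sle; exact.
Qed.

Lemma ac_line_abs_continuous V (a b : R) (f : R -> V) :
  ac_line f -> abs_continuous a b f.
Proof.
move=> acf e e0; have [d d0 H] := acf e e0; exists d => // k I Iab tI Id.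
have := H (map I (index_enum (ordinal k))); rewrite !big_map; apply => //.
- by rewrite all_map; apply/allP => i _ /=; have [_ []] := Iab i.
- rewrite pairwise_map; have := index_enum_uniq (ordinal k); rewrite uniq_pairwise.
  apply: sub_pairwise => i j ij; rewrite /nonoverlap/=.
  apply: contraT; rewrite !negb_or -!ltNge => /and4P[i12 j12 ij2 ji2].
  suff : i = j by move/eqP; rewrite (negbTE ij).
  have [x /andP[]] : exists x,
      Num.max (I i).1 (I j).1 < x < Num.min (I i).2 (I j).2.
    exists ((Num.max (I i).1 (I j).1 + Num.min (I i).2 (I j).2) / 2).
    have M : Num.max (I i).1 (I j).1 < Num.min (I i).2 (I j).2.
      by rewrite gt_max !lt_min i12 j12 ij2 ji2.
    by rewrite !midf_lt.
  rewrite gt_max lt_min => /andP[xi xj] /andP[ix jx].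
  by apply: tI => //; exists x; split; rewrite /= in_itv/= ?xi ?xj.
Qed.

Lemma ac_line_continuous V (f : R -> V) : ac_line f -> continuous f.
Proof.
move=> acf x; apply/cvgrPdist_lt => e e0; have [d d0 H] := acf e e0.
near=> t.
have : `|x - t| < d by near: t; exact: cvgr_dist_lt.
have [xt|/ltW tx] := leP x t.
  rewrite distrC => xtd; have := H [:: (x, t)].
  rewrite /= !big_seq1/= xt distrC; apply => //.
  by apply: le_lt_trans xtd; exact: ler_norm.
move=> xtd; have := H [:: (t, x)].
rewrite /= !big_seq1/= tx; apply => //.
by apply: le_lt_trans xtd; exact: ler_norm.
Unshelve. all: by end_near. Qed.

Lemma ac_line_dom V (f : R -> V) (g : R -> R) (K : R) :
  (forall x y : R, x <= y -> `|f y - f x| <= K * (g y - g x)) ->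
  ac_line g -> ac_line f.
Proof.
move=> fg acg e e0.
(* Positive whatever the sign of [K], hence a legitimate divisor of [e]. *)
have K0 : 0 < `|K| + 1 by rewrite ltr_pwDr.
have [d d0 H] := acg (e / (`|K| + 1)) (divr_gt0 e0 K0).
exists d => // s sle sno /(H _ sle sno); rewrite ltr_pdivlMr// => /(le_lt_trans _).
apply; rewrite mulr_suml big_seq [leRHS]big_seq; apply: ler_sum => p ps.
have p12 : p.1 <= p.2 by move/allP : sle; exact.
apply: (le_trans (fg _ _ p12)); apply: (le_trans (ler_norm _)).
by rewrite normrM mulrC ler_wpM2l// lerDl.
Qed.

Lemma ac_lineD V (f g : R -> V) : ac_line f -> ac_line g -> ac_line (f \+ g).
Proof.
move=> acf acg e e0; have e2 : 0 < e / 2 by rewrite divr_gt0.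
have [d d0 H] := acf _ e2; have [d' d'0 H'] := acg _ e2.
exists (Num.min d d') => [|s sle sno]; first by rewrite lt_min d0.
rewrite lt_min => /andP[/(H _ sle sno) A /(H' _ sle sno) B].
rewrite [ltRHS](splitr e); apply: le_lt_trans (ltrD A B).
rewrite -big_split/=; apply: ler_sum => p _.
by rewrite opprD addrACA ler_normD.
Qed.

End ac.

(** * Densities of nondecreasing absolutely continuous functions *)

Section density.
Context {R : realType}.
Notation mu := (@lebesgue_measure R).
Local Open Scope ereal_scope.

(** The measure bounds the distance between any two points of [I], so [I] is bounded and its
    endpoints are [inf I] and [sup I]. A degenerate pair represents the empty set. *)
Lemma lebesgue_measure_open_itv (I : set R) (d : R) :
  open I -> is_interval I -> mu I < d%:E ->
  exists2 p : R * R, (p.1 <= p.2)%R & I = `]p.1, p.2[%classic.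
Proof.
move=> oI iI Id.
have [->|/set0P[x Ix]] := eqVneq I set0.
  by exists (0%R, 0%R) => //=; rewrite set_itvoo0.
have width y z : I y -> I z -> (z - y <= d)%R.
  move=> Iy Iz; have [yz|] := leP y z; last first.
    move=> zy; have d0 : (0 <= d)%R by rewrite -lee_fin (le_trans _ (ltW Id)).
    by rewrite (le_trans _ d0)// subr_le0 ltW.
  rewrite -lee_fin (le_trans _ (ltW Id))//.
  have -> : (z - y)%:E = mu `[y, z].
    rewrite lebesgue_measure_itv/= lte_fin; case: ifPn => //.
    by rewrite -leNgt => zy; congr EFin; apply/eqP; rewrite subr_eq0 eq_le yz zy.
  apply: le_measure; rewrite ?inE//; first exact: open_measurable.
  by move=> t /=; rewrite in_itv/=; exact: iI.
have lI : has_lbound I.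
  by exists (x - d)%R => y Iy; have := width _ _ Iy Ix; lra.
have uI : has_ubound I.
  by exists (x + d)%R => y Iy; have := width _ _ Ix Iy; lra.
have IE : I = `]inf I, sup I[%classic.
  by rewrite -[LHS](interior_id I).1// interval_bounded_interior.
exists (inf I, sup I) => //=.
by move: Ix; rewrite {1}IE/= in_itv/= => /andP[xl xu]; exact/ltW/(lt_trans xl).
Qed.

Lemma lebesgue_stieltjes_itv_oc (w : cumulative R R) (a b : R) : (a <= b)%R ->
  lebesgue_stieltjes_measure w `]a, b] = (w b - w a)%:E.
Proof.
move=> ab; rewrite /lebesgue_stieltjes_measure /measure_extension.
rewrite measurable_mu_extE/=; last exact: is_ocitv.
by rewrite wlength_itv_bnd.
Qed.

(** By outer regularity a null set lies in an open set of measure less than [d]. The components of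
    that open set are disjoint intervals, to which the absolute continuity of [w] applies. *)
Lemma ac_line_dominates (w : cumulative R R) :
  ac_line (w : R -> R^o) -> lebesgue_stieltjes_measure w `<< mu.
Proof.
move=> acw; apply/null_content_dominatesP => A mA A0.
apply/eqP; rewrite eq_le measure_ge0 andbT; apply/lee_addgt0Pr => e e0.
rewrite add0e; have [d d0 H] := acw _ e0.
have [|U [oU AU]] := @lebesgue_regularity_outer _ A d mA _ d0.
  by rewrite [ltLHS]A0.
move=> Ud; have {}Ud : mu U < d%:E.
  rewrite -(setDUK AU) (le_lt_trans (measureU2 _ _ _))//.
    by apply: measurableD => //; exact: open_measurable.
  by rewrite [X in X + _](_ : _ = 0) ?add0e.
pose I := open_disjoint_itv oU.
have mI q : measurable (I q) := open_measurable (@open_disjoint_itv_open _ _ oU q).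
have IU q : I q `<=` U.
  by rewrite (open_disjoint_itv_bigcup oU) => x Ix; exists q.
have muI q : mu (I q) < d%:E.
  apply: le_lt_trans Ud; apply: le_measure; rewrite ?inE.
  - exact: mI.
  - exact: open_measurable.
  - exact: IU.
have /choice[p pP] : forall q, exists p : R * R,
    (p.1 <= p.2)%R /\ I q = `]p.1, p.2[%classic.
  move=> q; have [p] := lebesgue_measure_open_itv
    (@open_disjoint_itv_open _ _ oU q) (@open_disjoint_itv_is_interval _ _ oU q)
    (muI q).
  by exists p.
have tI : trivIset setT I by exact: open_disjoint_itv_trivIset.
have muE q : mu (I q) = ((p q).2 - (p q).1)%:E.
  have [pq ->] := pP q; rewrite lebesgue_measure_itv/= lte_fin; case: ifPn => //.
  by rewrite -leNgt => zy; congr EFin; apply/eqP; rewrite eq_sym subr_eq0 eq_le pq zy.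
have wI q : lebesgue_stieltjes_measure w (I q) <= (w (p q).2 - w (p q).1)%:E.
  have [pq IE] := pP q; rewrite -lebesgue_stieltjes_itv_oc//.
  apply: le_measure; rewrite ?inE; [exact: mI|exact: measurable_itv|].
  by rewrite IE; exact: subset_itv_oo_oc.
apply: (@le_trans _ _ (lebesgue_stieltjes_measure w U)).
  apply: le_measure; rewrite ?inE; [exact: mA|exact: open_measurable|exact: AU].
rewrite (open_disjoint_itv_bigcup oU).
rewrite measure_semi_bigcup; [|exact: mI|exact: tI|]; last first.
  by apply: bigcup_measurable => q _; exact: mI.
(* Absolute continuity speaks of finite families only, so the series over the components is bounded
   through its partial sums. *)
apply: lime_le; first exact: is_cvg_nneseries.
apply: nearW => k.
apply: (@le_trans _ _ (\sum_(0 <= q < k) (w (p q).2 - w (p q).1)%:E)).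
  by apply: lee_sum => q _; exact: wI.
rewrite sumEFin lee_fin ltW//.
apply: (@le_lt_trans _ _ (\sum_(p <- [seq p q | q <- index_iota 0 k])
    `|w p.2 - w p.1|)%R).
  by rewrite big_map; apply: ler_sum => q _; exact: ler_norm.
apply: H.
- by rewrite all_map; apply/allP => q _ /=; have [] := pP q.
- rewrite pairwise_map; have := iota_uniq 0 (k - 0); rewrite uniq_pairwise.
  apply: sub_pairwise => i j ij; rewrite /nonoverlap/=.
  apply: contraT; rewrite !negb_or -!ltNge => /and4P[i12 j12 ij2 ji2].
  suff : i = j by move/eqP; rewrite (negbTE ij).
  have [x /andP[]] : exists x,
      (Num.max (p i).1 (p j).1 < x < Num.min (p i).2 (p j).2)%R.
    exists ((Num.max (p i).1 (p j).1 + Num.min (p i).2 (p j).2) / 2)%R.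
    have M : (Num.max (p i).1 (p j).1 < Num.min (p i).2 (p j).2)%R.
      by rewrite gt_max !lt_min i12 j12 ij2 ji2.
    by rewrite !midf_lt.
  rewrite gt_max lt_min => /andP[xi xj] /andP[ix jx].
  apply: tI => //; exists x; split; [have [_ ->] := pP i|have [_ ->] := pP j].
    by rewrite /= in_itv/= xi.
  by rewrite /= in_itv/= xj.
rewrite big_map -lte_fin -sumEFin; apply: le_lt_trans Ud.
under eq_bigr do rewrite -muE.
rewrite (open_disjoint_itv_bigcup oU).
rewrite measure_semi_bigcup; [|exact: mI|exact: tI|]; last first.
  by apply: bigcup_measurable => q _; exact: mI.
exact: nneseries_lim_ge.
Qed.

End density.

Section density.
Context {R : realType}.
Notation mu := (@lebesgue_measure R).
Local Open Scope ereal_scope.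

(** [h] is the Radon-Nikodym derivative of the Stieltjes measure of [w], and the almost everywhere
    form of the fundamental theorem of calculus identifies it with the derivative. The bound [C]
    makes the measure finite, hence [h] integrable on the whole line. *)
Lemma ac_line_density (w : R -> R) (C : R) :
  {homo w : s t / (s <= t)%R} -> ac_line (w : R -> R^o) ->
  (forall s t, (w t - w s <= C)%R) ->
  exists h : R -> R, [/\ forall x, (0 <= h x)%R,
    mu.-integrable setT (EFin \o h),
    forall s t, (s <= t)%R -> \int[mu]_(x in `]s, t]) (h x)%:E = (w t - w s)%:E &
    {ae mu, forall x, derivable (w : R -> R^o) x 1 /\ derive1 (w : R -> R^o) x = h x}].
Proof.
move=> ndw acw wC.
have rcw : right_continuous w.
  by move=> x; apply: cvg_at_right_filter; exact: (ac_line_continuous acw).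
pose wc : cumulative R R := HB.pack w (isCumulative.Build R _ R w ndw rcw).
pose ls := lebesgue_stieltjes_measure wc.
have lsT : ls setT < +oo.
  rewrite -(bigcup_itvT false false).
  pose I n : set R := `](- (n%:R))%R, n%:R%R]%classic.
  have cvgI : (ls \o I) n @[n --> \oo] --> ls (\bigcup_n I n).
    apply: nondecreasing_cvg_mu; rewrite /I//; first exact: bigcup_measurable.
    by move=> *; apply/subsetPset/subset_itv; rewrite leBSide/= ?lerN2 ler_nat.
  rewrite (@le_lt_trans _ _ C%:E) ?ltry//.
  have <- := cvg_lim _ cvgI; last exact: ereal_hausdorff.
  apply: lime_le; first by apply/cvg_ex; exists (ls (\bigcup_n I n)).
  apply: nearW => n /=; rewrite /I /ls lebesgue_stieltjes_itv_oc ?lee_fin ?wC//.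
  by rewrite ge0_cp.
(* Restricting to the whole line changes no value; it packages [ls] as a finite measure. *)
pose nu := mfrestr (measurableT : measurable [set: measurableTypeR R]) lsT.
have nuE A : nu A = ls A by rewrite /nu /mfrestr /mrestr setIT.
have numu : nu `<< mu.
  apply/null_content_dominatesP => A mA A0; rewrite nuE.
  by have /null_content_dominatesP := @ac_line_dominates _ wc acw; exact.
have [f [f0 ff intf fE]] := radon_nikodym_sigma_finite numu.
pose h x := fine (f x).
have hE : EFin \o h = f by apply/funext => x; rewrite /= /h fineK.
have hitv s t : (s <= t)%R ->
    \int[mu]_(x in `]s, t]) (h x)%:E = (w t - w s)%:E.
  move=> st; transitivity (\int[mu]_(x in `]s, t]) f x).
    by apply: eq_integral => x _; rewrite /h fineK.
  by rewrite -fE// [LHS]nuE /ls lebesgue_stieltjes_itv_oc.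
exists h; split => //.
- by move=> x; rewrite fine_ge0.
- by rewrite hE.
have intNy y : mu.-integrable `]-oo, y] (EFin \o h).
  by rewrite hE; apply: integrableS intf.
have loch : locally_integrable [set: R] h.
  by apply: open_integrable_locally; [exact: openT|rewrite hE].
have := FTC1Ny intNy loch.
set F := fun x : R => _.
have Fw s t : (s <= t)%R -> (F t - F s = w t - w s)%R.
  move=> st; apply: EFin_inj; rewrite -hitv// EFinB /F !fineK; last 2 first.
  - exact: integrable_fin_num.
  - exact: integrable_fin_num.
  rewrite (@itv_bndbnd_setU _ _ -oo%O (BRight s) (BRight t))//.
  rewrite integral_setU//=.
  - rewrite addeAC subee ?add0e//; exact: integrable_fin_num.
  - by rewrite -itv_bndbnd_setU//; have /integrableP[] := intNy t.
  - apply/disj_setPS => x [] /=; rewrite !in_itv/= => xs /andP[sx _].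
    by move: xs; rewrite leNgt sx.
(* [w] and the primitive [F] of [h] have the same increments, so they differ by a constant. *)
have wE : w = (fun x => F x + (w 0 - F 0))%R.
  apply/funext => x; have [x0|/ltW x0] := leP x 0%R.
    by have := Fw _ _ x0; lra.
  by have := Fw _ _ x0; lra.
apply: filterS; first exact: (ae_filter_ringOfSetsType mu).
move=> x [dF FE].
have dc : derivable (cst (w 0 - F 0)%R : R -> R^o) x 1 by exact: derivable_cst.
have -> : w = (F \+ cst (w 0 - F 0))%R :> (R -> R) by exact: wE.
split; first exact: derivableD.
rewrite derive1E deriveD// derive_cst addr0 -FE derive1E//.
Qed.

End density.

(** * Total variation *)

Section variation.
Context {R : realType}.
Implicit Types (s r : seq (R * R)) (l : seq R) (g : R -> R).

Lemma nonoverlap_sym : symmetric (@nonoverlap R).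
Proof.
move=> p q; rewrite /nonoverlap orbCA; congr [|| _, _ | _]; exact: orbC.
Qed.

(** The strict inequality excludes the case where [p] is empty, in which [nonoverlap p q'] would say
    nothing about [q]. *)
Lemma nonoverlap_sub (p q q' : R * R) : p.1 < p.2 -> p.1 <= q.1 -> q.2 <= p.2 ->
  nonoverlap p q' -> nonoverlap q q'.
Proof.
move=> p12 pq qp; rewrite /nonoverlap leNgt p12 /=.
case/or3P => [->|H|H]; rewrite ?orbT//.
  by rewrite (le_trans qp H) !orbT.
by rewrite (le_trans H pq) !orbT.
Qed.

Definition pieces (a : R) l : seq (R * R) := zip (a :: l) l.

Lemma pieces_cons a x l : pieces a (x :: l) = (a, x) :: pieces x l.
Proof. by []. Qed.

Lemma all_pieces_le a l : path <%R a l -> all (fun p => p.1 <= p.2) (pieces a l).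
Proof.
elim: l a => // x l ih a /= /andP[ax /ih]; rewrite -/(pieces x l) => ->.
by rewrite ltW.
Qed.

Lemma pieces_range a l : path <%R a l ->
  all (fun p => (a <= p.1) && (p.2 <= last a l)) (pieces a l).
Proof.
elim: l a => // x l ih a /andP[ax xl]; rewrite pieces_cons /= lexx/=.
have := ih _ xl => /allP H.
have xL : x <= last x l.
  by have := mem_last x l; rewrite inE => /predU1P[->//|/(allP (lt_path_min xl))/ltW].
rewrite xL/=; apply/allP => p /H /andP[xp ->]; rewrite andbT.
by rewrite (le_trans (ltW ax)).
Qed.

Lemma pairwise_pieces a l : path <%R a l -> pairwise (@nonoverlap R) (pieces a l).
Proof.
elim: l a => // x l ih a /andP[ax xl]; rewrite pieces_cons pairwise_cons ih// andbT.
apply/allP => p /(allP (pieces_range xl))/andP[xp _].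
by rewrite /nonoverlap/= xp !orbT.
Qed.

Lemma sum_pieces a l : \sum_(p <- pieces a l) (p.2 - p.1) = last a l - a.
Proof.
elim: l a => [a|x l ih a]; first by rewrite big_nil subrr.
by rewrite pieces_cons big_cons ih/= addrC subrKA.
Qed.

Lemma variation_pieces a b g l : itv_partition a b l ->
  variation a b g l = \sum_(p <- pieces a l) `|g p.2 - g p.1|.
Proof.
move=> /variation_zip ->; elim: l a => [a|x l ih a]; first by rewrite !big_nil.
by rewrite pieces_cons !big_cons -ih.
Qed.

(* The variations over the intervals of [s] are replaced one after the other by
   sums over partitions, whose pieces accumulate in [r]. *)
Lemma sum_total_variation_le g (e d : R) :
  (forall s, all (fun p => p.1 <= p.2) s -> pairwise nonoverlap s ->
    \sum_(p <- s) (p.2 - p.1) < d -> \sum_(p <- s) `|g p.2 - g p.1| < e) ->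
  forall s r, all (fun p => p.1 <= p.2) (s ++ r) -> pairwise nonoverlap (s ++ r) ->
    \sum_(p <- s ++ r) (p.2 - p.1) < d ->
    (\sum_(p <- s) total_variation p.1 p.2 g +
      (\sum_(p <- r) `|g p.2 - g p.1|)%:E <= e%:E)%E.
Proof.
move=> H; elim=> [r rle rno rd|p s ih r].
  by rewrite big_nil add0e lee_fin ltW// H.
rewrite cat_cons => /=/andP[p12 srle] /andP[psr srno]; rewrite big_cons => psrd.
rewrite big_cons -addeA; set c := (X in (_ + X)%E).
have sum_ge0 : 0 <= p.2 - p.1 by rewrite subr_ge0.
have [p12E|p12N] := eqVneq p.1 p.2.
  rewrite p12E total_variationxx add0e; apply: ih => //.
  by apply: le_lt_trans psrd; rewrite lerDr.
have {p12 p12N}p12 : p.1 < p.2 by rewrite lt_neqAle p12N.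
have c0 : (0 <= c)%E.
  rewrite adde_ge0//; last by rewrite lee_fin sumr_ge0.
  rewrite big_seq sume_ge0// => q qs; apply: total_variation_ge0.
  by move/allP : srle; apply; rewrite mem_cat qs.
(* The pieces of a partition of [p] join [r]: they stay inside [p] and have the same total length,
   so the induction hypothesis applies. *)
have Hl l : itv_partition p.1 p.2 l -> ((variation p.1 p.2 g l)%:E + c <= e%:E)%E.
  move=> pl; have [lp /eqP ll] := pl; rewrite addeCA -EFinD variation_pieces//.
  rewrite -big_cat/=; apply: ih.
  - by move: srle; rewrite !all_cat => /andP[-> ->]; rewrite all_pieces_le.
  - move: srno psr; rewrite !pairwise_cat allrel_catr all_cat.
    move=> /and3P[-> -> ->] /andP[ps pr]; rewrite pairwise_pieces//= !andbT.
    have Hq q q' : q \in pieces p.1 l -> nonoverlap p q' -> nonoverlap q q'.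
      move=> /(allP (pieces_range lp))/andP[pq]; rewrite ll => qp.
      exact: nonoverlap_sub.
    apply/andP; split; apply/allrelP => q q' qs q's.
      by rewrite nonoverlap_sym; apply: Hq => //; exact: (allP ps).
    by apply: Hq => //; exact: (allP pr).
  - by move: psrd; rewrite !big_cat/= sum_pieces ll addrCA.
(* The trivial partition of [p] already bounds [c] by [e]; finiteness then allows [c] to be
   subtracted before taking the supremum over partitions. *)
have cfin : c \is a fin_num.
  rewrite ge0_fin_numE//; have := Hl _ (itv_partition1 p12).
  move=> /(le_trans _) => /(_ c) /(_ _)/le_lt_trans; apply; last exact: ltry.
  by rewrite leeDr// lee_fin variation_ge0.
rewrite -leeBrDr// ; apply: ge_ereal_sup => _ [_ [l pl <-] <-].
by rewrite leeBrDr// Hl.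
Qed.

End variation.

Section variation.
Context {R : realType}.
Implicit Types (g : R -> R).
Notation TV := total_variation.

Lemma ac_line_total_variation_le g (e : R) : ac_line (g : R -> R^o) -> 0 < e ->
  exists2 d : R, 0 < d & forall s : seq (R * R), all (fun p => p.1 <= p.2) s ->
    pairwise nonoverlap s -> \sum_(p <- s) (p.2 - p.1) < d ->
    (\sum_(p <- s) TV p.1 p.2 g <= e%:E)%E.
Proof.
move=> acg e0; have [d d0 H] := acg e e0; exists d => // s sle sno sd.
have := sum_total_variation_le H (s := s) (r := [::]).
by rewrite cats0 big_nil adde0; exact.
Qed.

(** Each step of length [d / 2] contributes at most 1 to the variation, and finitely many such steps
    cover [[a, b]]. *)
Lemma ac_line_total_variation_fin g (a b : R) : ac_line (g : R -> R^o) -> a <= b ->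
  TV a b g \is a fin_num.
Proof.
move=> acg ab; have [d d0 H] := ac_line_total_variation_le acg ltr01.
have Hk k : (TV a (a + k%:R * (d / 2)) g <= k%:R%:E)%E.
  elim: k => [|k ih]; first by rewrite mul0r addr0 total_variationxx.
  have kd : 0 <= k%:R * (d / 2) by rewrite mulr_ge0// divr_ge0// ltW.
  have ac : a <= a + k%:R * (d / 2) by rewrite lerDl.
  have cb : a + k%:R * (d / 2) <= a + k.+1%:R * (d / 2).
    by rewrite -[k.+1%:R]natr1 mulrDl; lra.
  rewrite (total_variationD _ ac cb) -[k.+1%:R]natr1 EFinD leeD//.
  have := H [:: (a + k%:R * (d / 2), a + (k%:R + 1) * (d / 2))].
  rewrite /= !big_seq1/= => -> //; rewrite ?andbT; lra.
have [k kb] : exists k : nat, b <= a + k%:R * (d / 2).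
  exists (Num.bound ((b - a) / (d / 2))).
  rewrite -lerBlDl -ler_pdivrMr ?divr_gt0//.
  by rewrite ltW// archi_boundP// divr_ge0 ?subr_ge0// ltW// divr_gt0.
rewrite ge0_fin_numE ?total_variation_ge0//.
apply: le_lt_trans (ltry k%:R); apply: le_trans (Hk k).
by rewrite (total_variationD _ ab kb) leeDl// total_variation_ge0.
Qed.

(** [v t] is the variation of the clipped function from [a] to [clip a b t]; its values lie between
    0 and [v b]. *)
Lemma abs_continuous_variation (a b : R) (f : R -> R) : a <= b ->
  abs_continuous a b (f : R -> R^o) ->
  exists v : R -> R, [/\ {homo v : s t / s <= t}, ac_line (v : R -> R^o),
    exists C, forall s t, v t - v s <= C &
    forall s t, s <= t -> `|f (clip a b t) - f (clip a b s)| <= v t - v s].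
Proof.
move=> ab /(abs_continuous_clip ab); set g := f \o clip a b => acg.
have fin s t : s <= t -> TV s t g \is a fin_num.
  exact: ac_line_total_variation_fin.
pose v t := fine (TV a (clip a b t) g).
have vB s t : s <= t -> (v t - v s)%:E = TV (clip a b s) (clip a b t) g.
  move=> st; rewrite EFinB !fineK ?fin ?clip_ge//.
  rewrite (total_variationD _ (clip_ge a b s) (le_clip a b st)) addeAC subee ?add0e//.
  by rewrite fin// clip_ge.
have nd s t : s <= t -> v s <= v t.
  by move=> st; rewrite -subr_ge0 -lee_fin vB// total_variation_ge0// le_clip.
exists v; split => //.
- move=> e e0; have e2 : 0 < e / 2 by rewrite divr_gt0.
  have [d d0 H] := ac_line_total_variation_le acg e2; exists d => // s sle sno sd.
  have sE : (\sum_(p <- s) `|v p.2 - v p.1| <= e / 2); last first.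
    by rewrite (le_lt_trans sE)//; lra.
  rewrite -lee_fin -sumEFin.
  (* The increments of [v] along [s] are the variations of [g] over the clipped intervals, which
     remain nonoverlapping and do not get longer. *)
  have := H [seq (clip a b p.1, clip a b p.2) | p <- s]; rewrite !big_map/=.
  rewrite [X in _ -> _ -> _ -> is_true (X <= _)%E](_ : _ =
      \sum_(p <- s) `|v p.2 - v p.1|%:E)%E; last first.
    rewrite big_seq [RHS]big_seq; apply: eq_bigr => p ps.
    have p12 : p.1 <= p.2 by move/allP : sle; exact.
    by rewrite ger0_norm ?vB// subr_ge0 nd.
  apply.
  + rewrite all_map; apply/allP => p ps /=; rewrite le_clip//.
    by move/allP : sle; exact.
  + rewrite pairwise_map; apply: sub_pairwise sno => p q; rewrite /nonoverlap/=.
    by case/or4P => H1; apply/or4P; [constructor 1|constructor 2|constructor 3|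
      constructor 4]; exact: le_clip.
  + apply: le_lt_trans sd; rewrite big_seq [leRHS]big_seq.
    apply: ler_sum => p ps; rewrite clip_lip//.
    by move/allP : sle; exact.
- exists (v b) => s t; rewrite lerBlDr ler_wpDr//.
    by rewrite fine_ge0// total_variation_ge0// clip_ge.
  rewrite -subr_ge0 -lee_fin /v EFinB !fineK ?fin ?clip_ge//.
  rewrite (@clip_id _ a b b) ?ab ?lexx//.
  rewrite (total_variationD _ (clip_ge a b t) (clip_le t ab)) addeAC subee ?add0e//.
    by rewrite total_variation_ge0// clip_le.
  by rewrite fin// clip_ge.
- move=> s t st; rewrite -lee_fin vB// (le_trans _ (total_variation_ge _ _))//.
    by rewrite /g/= !(@clip_id _ a b (clip _ _ _))// clip_ge clip_le.
  exact: le_clip.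
Qed.

End variation.

(** * Functions controlled by an absolutely continuous one *)

Section controlled.
Context {R : realType}.
Notation mu := (@lebesgue_measure R).

(** The bound on the increments makes the Stieltjes measure of [v] finite. *)
Definition control (v : R -> R) : Prop :=
  [/\ {homo v : s t / s <= t}, ac_line (v : R -> R^o) &
      exists C, forall s t, v t - v s <= C].

Definition controlled_by (V : normedModType R) (v : R -> R) (f : R -> V) : Prop :=
  forall s t, s <= t -> `|f t - f s| <= v t - v s.

Lemma control_dominated (v w : R -> R) (K : R) : control v ->
  {homo w : s t / s <= t} -> (forall s t, s <= t -> w t - w s <= K * (v t - v s)) ->
  control w.
Proof.
move=> [ndv acv [C vC]] ndw wv; split => //.
  apply: (ac_line_dom (K := K) _ acv) => s t st.
  by rewrite ger0_norm ?wv// subr_ge0 ndw.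
exists (`|K| * C) => s t; have [st|/ltW ts] := leP s t.
  rewrite (le_trans (wv _ _ st))// (le_trans (ler_norm _))//.
  by rewrite normrM ler_wpM2l// ger0_norm ?vC// subr_ge0 ndv.
rewrite (@le_trans _ _ 0) ?subr_le0 ?ndw// mulr_ge0//.
by rewrite (le_trans _ (vC 0 0))// subrr.
Qed.

Lemma controlZ (v : R -> R) (K : R) : 0 <= K -> control v -> control (fun t => K * v t).
Proof.
move=> K0 cv; apply: (@control_dominated v _ K cv) => s t st.
  by rewrite ler_wpM2l//; case: cv => + _ _; exact.
by rewrite mulrBr.
Qed.

Lemma controlD (v w : R -> R) : control v -> control w -> control (v \+ w).
Proof.
move=> [ndv acv [C vC]] [ndw acw [D wD]]; split.
- by move=> s t st; rewrite /= lerD// ?ndv ?ndw.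
- exact: (@ac_lineD R R^o v w).
- exists (C + D) => s t; have := vC s t; have := wD s t; rewrite /=; lra.
Qed.

Lemma control0 : control (cst 0).
Proof.
split => //.
  move=> e e0; exists 1 => // s _ _ _.
  by rewrite big1// => p _; rewrite subrr normr0.
by exists 0 => s t; rewrite subrr.
Qed.

(** The function [w \+ v] is nondecreasing with increments at most twice those of [v], so [w] is a
    difference of two functions that have densities. *)
Lemma controlled_by_ae_derivable (v w : R -> R) : control v ->
  controlled_by (V := R^o) v w -> {ae mu, forall x, derivable (w : R -> R^o) x 1}.
Proof.
move=> cv wv; have [ndv acv [C vC]] := cv.
have [ndz acz [D zD]] : control (w \+ v).
  apply: (@control_dominated v _ 2 cv) => s t st; have := wv _ _ st.
    by rewrite ler_norml => /andP[]; rewrite /=; lra.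
  by rewrite ler_norml => /andP[]; rewrite /=; lra.
have [h [_ _ _ vh]] := ac_line_density ndv acv vC.
have [k [_ _ _ zk]] := ac_line_density ndz acz zD.
have aeF := ae_filter_ringOfSetsType mu.
move: vh zk; apply: filterS2 => x [dv _] [dz _].
have -> : w = (w \+ v) \- v by apply/funext => y; rewrite /= addrK.
exact: derivableB.
Qed.

(** The increments of [w \+ v] and of [v] are the integrals of their derivatives, and the sign of
    the derivative of [w] compares the two integrands. *)
Lemma controlled_by_nonincreasing (v w : R -> R) (a b : R) : control v ->
  controlled_by (V := R^o) v w -> a <= b ->
  {ae mu, forall x, x \in `]a, b] -> derive1 (w : R -> R^o) x <= 0} ->
  w b <= w a.
Proof.
move=> cv wv ab w'0; have [ndv acv [C vC]] := cv.
have [ndz acz [D zD]] : control (w \+ v).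
  apply: (@control_dominated v _ 2 cv) => s t st; have := wv _ _ st.
    by rewrite ler_norml => /andP[]; rewrite /=; lra.
  by rewrite ler_norml => /andP[]; rewrite /=; lra.
have [h [h0 ih hE vh]] := ac_line_density ndv acv vC.
have [k [k0 ik kE zk]] := ac_line_density ndz acz zD.
suff : (w \+ v) b - (w \+ v) a <= v b - v a by rewrite /=; lra.
rewrite -lee_fin -hE// -kE//; apply: ae_ge0_le_integral => //.
- by move=> x _; rewrite lee_fin.
- by apply: measurable_funTS; have /integrableP[] := ik.
- by move=> x _; rewrite lee_fin.
- by apply: measurable_funTS; have /integrableP[] := ih.
have aeF := ae_filter_ringOfSetsType mu.
move: w'0 vh zk; apply: filterS3 => x w'0 [dv v'] [dz z'] xab.
rewrite lee_fin -v' -z'.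
have wE : (w : R -> R^o) = (w \+ v) \- v by apply/funext => y; rewrite /= addrK.
have := w'0 xab; rewrite [X in derive1 X]wE derive1E deriveB// -!derive1E.
by rewrite subr_le0.
Qed.

Lemma controlled_by_ae_derivable_mx n (v : R -> R) (f : R -> 'rV[R]_n) : control v ->
  controlled_by v f -> {ae mu, forall x, derivable f x 1}.
Proof.
move=> cv fv; have aeF := ae_filter_ringOfSetsType mu.
have : forall j, {ae mu, forall x, derivable (fun t => f t ord0 j : R^o) x 1}.
  move=> j; apply: (controlled_by_ae_derivable cv) => s t st.
  rewrite (le_trans _ (fv _ _ st))// [leRHS]/Num.Def.normr/= mx_normrE.
  by apply: le_trans; last exact: (le_bigmax _ _ (ord0, j)); rewrite !mxE.
move=> /filter_forall; apply: filterS => x fx; apply/derivable_mxP => i j.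
by rewrite ord1; exact: fx.
Qed.

End controlled.

(** * Euclidean geometry of row vectors *)

Section dot.
Context {R : realType} {n : nat}.
Implicit Types x y z : 'rV[R]_n.

Lemma dotC x y : dot x y = dot y x.
Proof. by apply: eq_bigr => j _; rewrite mulrC. Qed.

Lemma dotDl x y z : dot (x + y) z = dot x z + dot y z.
Proof. by rewrite -big_split; apply: eq_bigr => j _; rewrite mxE mulrDl. Qed.

Lemma dotZl a x y : dot (a *: x) y = a * dot x y.
Proof. by rewrite mulr_sumr; apply: eq_bigr => j _; rewrite mxE mulrA. Qed.

Lemma dotNl x y : dot (- x) y = - dot x y.
Proof. by rewrite -scaleN1r dotZl mulN1r. Qed.

Lemma dotBl x y z : dot (x - y) z = dot x z - dot y z.
Proof. by rewrite dotDl dotNl. Qed.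

Lemma dotDr x y z : dot x (y + z) = dot x y + dot x z.
Proof. by rewrite !(dotC x) dotDl. Qed.

Lemma dotZr a x y : dot x (a *: y) = a * dot x y.
Proof. by rewrite !(dotC x) dotZl. Qed.

Lemma dotNr x y : dot x (- y) = - dot x y.
Proof. by rewrite !(dotC x) dotNl. Qed.

Lemma dotBr x y z : dot x (y - z) = dot x y - dot x z.
Proof. by rewrite dotDr dotNr. Qed.

Definition dotE := (dotDl, dotDr, dotBl, dotBr, dotZl, dotZr, dotNl, dotNr).

Lemma dot_ge0 x : 0 <= dot x x.
Proof. by rewrite sumr_ge0// => j _; rewrite -expr2 sqr_ge0. Qed.

Lemma ler_coord_norm x j : `|x ord0 j| <= `|x|.
Proof.
rewrite [leRHS]/Num.Def.normr/= mx_normrE.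
exact: (le_bigmax _ (fun ij => `|x ij.1 ij.2|) (ord0, j)).
Qed.

Lemma norm_rV_le x (e : R) : 0 <= e -> (forall j, `|x ord0 j| <= e) -> `|x| <= e.
Proof.
move=> e0 xe; rewrite [leLHS]/Num.Def.normr/= mx_normrE bigmax_le// => -[i j] _ /=.
by rewrite ord1.
Qed.

Lemma norm_rV_le_sum x : `|x| <= \sum_j `|x ord0 j|.
Proof.
apply: norm_rV_le => [|j]; first exact: sumr_ge0.
by rewrite (bigD1 j)//= lerDl sumr_ge0.
Qed.

Lemma ler_norm_dot x y : `|dot x y| <= n%:R * `|x| * `|y|.
Proof.
apply: (le_trans (ler_norm_sum _ _ _)).
apply: (@le_trans _ _ (\sum_(j < n) `|x| * `|y|)).
  by apply: ler_sum => j _; rewrite normrM ler_pM// ler_coord_norm.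
by rewrite sumr_const card_ord -[X in X <= _]mulr_natl mulrA.
Qed.

Lemma norm_sqr_le_dot x : `|x| ^+ 2 <= dot x x.
Proof.
rewrite -(sqr_sqrtr (dot_ge0 x)) lerXn2r ?nnegrE ?sqrtr_ge0//.
apply: norm_rV_le => [|j].
  exact: sqrtr_ge0.
rewrite -sqrtr_sqr ler_sqrt ?dot_ge0// /dot (bigD1 j)//= -expr2 lerDl.
by rewrite sumr_ge0// => i _; rewrite -expr2 sqr_ge0.
Qed.

Lemma cvg_dot (T : Type) (F : set_system T) {FF : Filter F} (f g : T -> 'rV[R]_n) x y :
  f @ F --> x -> g @ F --> y -> dot (f t) (g t) @[t --> F] --> dot x y.
Proof.
move=> fx gy; apply: cvg_big => [|j _]; first exact: add_continuous.
have coord (h : T -> 'rV[R]_n) z : h @ F --> z ->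
    h t ord0 j @[t --> F] --> z ord0 j.
  by move=> hz; exact: (cvg_comp _ _ hz (@coord_continuous R 1 n ord0 j z)).
by apply: cvgM; exact: coord.
Qed.

(** The squared Euclidean distance attains its minimum on a compact sublevel set in [C]; an acute
    angle at the minimizer would let a small move towards [z] decrease it. *)
Lemma exists_projection (C : set 'rV[R]_n) x : closed C -> C !=set0 ->
  (forall y z (l : R), C y -> C z -> 0 <= l <= 1 -> C (y + l *: (z - y))) ->
  exists2 y, C y & forall z, C z -> dot (x - y) (z - y) <= 0.
Proof.
move=> cC [c Cc] convC; pose f y : R := dot (y - x) (y - x).
have cf : continuous f.
  move=> y; have cyx : z - x @[z --> y] --> y - x.
    exact: (cvgB cvg_id (cvg_cst x)).
  exact: (cvg_dot cyx cyx).
pose A := C `&` [set y | f y <= f c].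
have cA : closed A.
  apply: closedI => //; apply: (@preimage_closed _ _ f [set r | r <= f c]).
    by move=> y _; exact: cf.
  exact: closed_le.
have bA : bounded_set A.
  exists (`|x| + (f c + 1)); split; first exact: num_real.
  move=> M ltM y [_ /= yc]; rewrite (le_trans _ (ltW ltM))//.
  rewrite -[y](subrK x) (le_trans (ler_normD _ _))// addrC lerD2l.
  have := norm_sqr_le_dot (y - x); rewrite -/(f y) => yx.
  have {yx} := le_trans yx yc; move: `|y - x| (f c) => s t st.
  have := sqr_ge0 (s - 1); nra.
have [|y yA ymin] := EVT_min_rV _ (bounded_closed_compact bA cA)
  (continuous_subspaceT cf); first by exists c; split => /=.
move: yA; rewrite inE => -[Cy yc]; exists y => // z Cz; rewrite leNgt; apply/negP => D0.
set D := dot (x - y) (z - y) in D0; set Q := dot (z - y) (z - y).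
have Q0 : 0 <= Q := dot_ge0 _.
have DQ : 0 < D + Q by rewrite ltr_wpDr.
(* With [D + Q] as denominator, [l] is positive and at most 1 whether or not [Q] vanishes, and the
   squared distance changes by [- l * D - l ^+ 2 * D], which is negative. *)
pose l := D / (D + Q).
have l0 : 0 < l by rewrite divr_gt0.
have l1 : l <= 1 by rewrite ler_pdivrMr// mul1r lerDl.
have lDQ : l * (D + Q) = D by rewrite divfK// gt_eqF.
have : f y <= f (y + l *: (z - y)).
  have [fy|/ltW fy] := leP (f (y + l *: (z - y))) (f c).
    by apply: ymin; rewrite inE; split => //; apply: convC; rewrite // ltW.
  exact: le_trans fy.
have -> : f (y + l *: (z - y)) = f y - 2 * l * D + l ^+ 2 * Q.
  rewrite /f /D /Q addrAC !dotE (dotC z y) (dotC z x) (dotC y x).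
  ring.
have lQ : l * Q = D - l * D by move: lDQ; rewrite mulrDr; lra.
have -> : l ^+ 2 * Q = l * (D - l * D) by rewrite expr2 -mulrA lQ.
have lD0 : 0 < l * D := mulr_gt0 l0 D0.
have := mulr_gt0 l0 lD0; rewrite mulrBr; lra.
Qed.

End dot.

(** * A common control for the data, and induction along an interval *)

Section data.
Context {R : realType}.

Lemma control_sum (I : Type) (r : seq I) (v : I -> R -> R) :
  (forall i, control (v i)) -> control (fun t => \sum_(i <- r) v i t).
Proof.
move=> cv; elim: r => [|i r ih].
  by under eq_fun do rewrite big_nil; exact: control0.
under eq_fun do rewrite big_cons; exact: (controlD (cv i) ih).
Qed.

Lemma controlled_by_widen (V : normedModType R) (v w : R -> R) (f : R -> V) :
  {homo w : s t / s <= t} -> controlled_by v f -> controlled_by (v \+ w) f.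
Proof.
move=> ndw vf s t st; apply: (le_trans (vf _ _ st)).
by have := ndw _ _ st; rewrite /=; lra.
Qed.

Lemma controlled_by_sum (I : finType) (V : I -> normedModType R)
    (v : I -> R -> R) (f : forall i, R -> V i) :
  (forall i, control (v i)) -> (forall i, controlled_by (v i) (f i)) ->
  forall i, controlled_by (fun t => \sum_j v j t) (f i).
Proof.
move=> cv vf i s t st; apply: (le_trans (vf _ _ _ st)); rewrite -sumrB.
rewrite (bigD1 i)//= lerDl sumr_ge0// => j _; rewrite subr_ge0.
by case: (cv j) => + _ _; exact.
Qed.

Lemma abs_continuous_control (a b : R) (f : R -> R) : a <= b ->
  abs_continuous a b (f : R -> R^o) ->
  exists2 v, control v & controlled_by (v : R -> R) (f \o clip a b : R -> R^o).
Proof.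
by move=> ab /(abs_continuous_variation ab)[v [ndv acv vC fv]]; exists v.
Qed.

Lemma abs_continuous_rV_control n (a b : R) (f : R -> 'rV[R]_n) : a <= b ->
  abs_continuous a b f ->
  exists2 v, control v & controlled_by v (f \o clip a b).
Proof.
move=> ab acf.
have /choice[v vP] : forall j, exists v, control v /\
    controlled_by v ((fun t => f t ord0 j) \o clip a b : R -> R^o).
  move=> j; suff /(abs_continuous_control ab)[v cv vf] :
      abs_continuous a b ((fun t => f t ord0 j) : R -> R^o) by exists v.
  move=> e e0; have [d d0 H] := acf e e0; exists d => // k I Iab tI Id.
  apply: le_lt_trans (H k I Iab tI Id); apply: ler_sum => i _.
  by rewrite (le_trans _ (ler_coord_norm _ j))// !mxE.
exists (fun t => \sum_j v j t); first by apply: control_sum => j; case: (vP j).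
move=> s t st; apply: (le_trans (norm_rV_le_sum _)); rewrite -sumrB.
by apply: ler_sum => j _; have [_ /(_ _ _ st)] := vP j; rewrite /= !mxE.
Qed.

(** The supremum of the points reachable from [a] is itself reachable, and can be passed unless it
    is [b]. This turns local existence of solutions into existence on the whole interval. *)
Lemma cousin (P : R -> R -> Prop) (a b : R) : a <= b ->
  (forall x y z, x <= y -> y <= z -> P x y -> P y z -> P x z) ->
  (forall t, exists2 d, 0 < d &
    forall x y, t - d < x -> x <= t -> t <= y -> y < t + d -> P x y) ->
  P a b.
Proof.
move=> ab Padd Ploc; pose S := [set t | a <= t <= b /\ P a t].
have Sa : S a.
  split; first by rewrite lexx.
  by have [d d0] := Ploc a; apply; lra.
have bS : ubound S b by move=> t [/andP[]].
have hS : has_sup S by split; [exists a|exists b].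
have ubS t : S t -> t <= sup S by move=> St; apply: sup_upper_bound.
have ac : a <= sup S by exact: ubS.
have cb : sup S <= b by apply: ge_sup => //; exists a.
have [d d0 Pd] := Ploc (sup S).
have [s [/andP[as_ sb] Pas] sd] := sup_adherent d0 hS.
have sc : s <= sup S by apply: ubS; split => //; rewrite as_.
have Pac : P a (sup S).
  by apply: (Padd _ s) => //; apply: Pd; lra.
pose y := Num.min b (sup S + d / 2).
have cy : sup S <= y by rewrite le_min cb/=; lra.
have Pay : P a y.
  apply: (Padd _ (sup S)) => //; apply: Pd => //; first lra.
  by rewrite gt_min; apply/orP; right; lra.
have : S y by split => //; rewrite ge_min lexx (le_trans ac cy).
move=> /ubS; rewrite ge_min => /orP[bc|]; last lra.
by have -> : b = sup S by apply/eqP; rewrite eq_le bc cb.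
Qed.

End data.

(** * The catching-up scheme *)

Lemma fmap_ultra (T U : Type) (f : T -> U) (F : set_system T) :
  UltraFilter F -> UltraFilter (f @ F).
Proof.
move=> FU; apply: Build_UltraFilter => G GP FG; apply/seteqP; split; last exact: FG.
move=> A GA; have [//|FA] := in_ultra_setVsetC (f @^-1` A) FU.
have GA' : G (~` A) by exact: FG.
have : G set0 by rewrite -(setICr A); exact: filterI.
by move=> /filter_ex[].
Qed.

(** The slack [e] accommodates estimates whose error vanishes only in the limit. *)
Lemma cvg_le_near (R : realType) (T : Type) (F : set_system T) (FF : ProperFilter F)
    (f : T -> R) (l c : R) : f @ F --> l ->
  (forall e, 0 < e -> \forall t \near F, f t <= c + e) -> l <= c.
Proof.
move=> fl H; rewrite leNgt; apply/negP => cl.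
have lc2 : 0 < (l - c) / 2 by rewrite divr_gt0// subr_gt0.
have fgt : \forall t \near F, c + (l - c) / 2 < f t.
  by apply: (cvgr_gt l fl); lra.
have [t [ft]] := filter_ex (filterI fgt (H _ lc2)).
by rewrite leNgt ft.
Qed.

Section obtuse.
Context {R : realType} {n : nat}.
Variables x q z : 'rV[R]_n.
Hypothesis obtuse : dot (x - q) (z - q) <= 0.

(** By the law of cosines, the side opposite to an obtuse or right angle at [q] is the longest. For
    a projection [q] of [x], this bounds the step by the distance to any feasible [z]. *)
Lemma dot_obtuse_center : dot (q - x) (q - x) <= dot (z - x) (z - x).
Proof.
move: obtuse (dot_ge0 (z - q)).
by rewrite !dotE (dotC q x) (dotC z x) (dotC z q); lra.
Qed.

(** The other side of the same triangle: projecting does not move away from points of the set. *)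
Lemma dot_obtuse_target : dot (q - z) (q - z) <= dot (x - z) (x - z).
Proof.
move: obtuse (dot_ge0 (x - q)).
by rewrite !dotE (dotC q x) (dotC z x) (dotC z q); lra.
Qed.

End obtuse.

Section sweeping.
Context {R : realType} {n m : nat}.
Variables (u : 'I_m -> R -> 'rV[R]_n) (b : 'I_m -> R -> R) (v : R -> R).
Hypothesis ndv : {homo v : s t / s <= t}.
Hypothesis uv : forall i, controlled_by v (u i).
Hypothesis bv : forall i, controlled_by (v : R -> R) (b i : R -> R^o).
Local Notation C := (polyhedron u b).
Implicit Types (x y z p : 'rV[R]_n) (s t : R).

Lemma polyhedron_convex t y z (l : R) : C t y -> C t z -> 0 <= l <= 1 ->
  C t (y + l *: (z - y)).
Proof.
move=> Cy Cz /andP[l0 l1] i; have := Cy i; have := Cz i; rewrite !dotE.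
by move: (dot _ z) (dot _ y) (b i t) => zi yi bi; nra.
Qed.

Lemma polyhedron_closed t : closed (C t).
Proof.
have -> : C t = \bigcap_(i in [set: 'I_m]) (dot (u i t) @^-1` [set r | r <= b i t]).
  by apply/seteqP; split => [x Cx i _|x Cx i]; [exact: Cx|exact: (Cx i)].
apply: closed_bigI => i _; apply: preimage_closed; last exact: closed_le.
by move=> x _; exact: (cvg_dot (@cvg_cst _ (u i t) _ _ (nbhs_filter x)) cvg_id).
Qed.

(** The term with the factor [n] bounds the change of the inner product, the sup norm being used in
    Cauchy-Schwarz; the summand 1 accounts for the change of [b i]. *)
Lemma polyhedron_drift s t x (M : R) i : s <= t -> C s x -> n%:R * `|x| + 1 <= M ->
  dot (u i t) x <= b i t + M * (v t - v s).
Proof.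
move=> st Cx xM; have := Cx i => Cxi.
have := ler_norm (dot (u i t - u i s) x).
move=> /le_trans /(_ (ler_norm_dot _ _)); rewrite dotBl => ux.
have vst : 0 <= v t - v s by rewrite subr_ge0 ndv.
have nx : 0 <= n%:R * `|x| by rewrite mulr_ge0.
have := ler_wpM2l nx (uv i st); have := ler_wpM2r vst xM.
have := bv i st; rewrite ler_norml => /andP[bst _].
move: ux; rewrite mulrAC; nra.
Qed.

(** Moving [x] slightly towards [p] compensates the drift of the constraints by the margin [d] and
    gives a point [z] of [C t] near [x]; the projection [q] is at least as close in Euclidean
    distance. *)
Lemma projection_step s t x p q (r d : R) : s <= t -> 0 < d ->
  C s x -> `|x - p| <= r -> (forall i, dot (u i t) p + d <= b i t) ->
  C t q -> (forall z, C t z -> dot (x - q) (z - q) <= 0) ->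
  `|q - x| <= n.+1%:R * r * (n%:R * (r + `|p|) + 1) / d * (v t - v s).
Proof.
move=> st d0 Cx xp Sp Cq qP; set M := n%:R * (r + `|p|) + 1.
have r0 : 0 <= r := le_trans (normr_ge0 _) xp.
have vst : 0 <= v t - v s by rewrite subr_ge0 ndv.
have xM : n%:R * `|x| + 1 <= M.
  rewrite lerD2r ler_wpM2l// -[X in `|X|](subrK p) (le_trans (ler_normD _ _))//.
  by rewrite lerD2r.
have M0 : 0 <= M by rewrite addr_ge0// mulr_ge0// addr_ge0.
pose w := M * (v t - v s) / d.
have w0 : 0 <= w by rewrite divr_ge0 ?mulr_ge0// ltW.
(* At [z] a constraint is exceeded by at most [d * ((1 - l) * w - l)], which is nonpositive for this
   [l]. *)
pose l := Num.min 1 w.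
have l0 : 0 <= l by rewrite le_min ler01.
have l1 : l <= 1 by rewrite ge_min lexx.
have lw : l <= w by rewrite ge_min lexx orbT.
pose z := x + l *: (p - x).
have Cz : C t z.
  move=> i; rewrite /z !dotE; have := polyhedron_drift i st Cx xM.
  have -> : M * (v t - v s) = w * d by rewrite /w divfK// gt_eqF.
  have := Sp i; move: (dot _ x) (dot _ p) (b i t) => xi pi bi pd xw.
  have : (1 - l) * w <= l.
    by rewrite /l; have [w1|w1] := leP 1 w; nra.
  nra.
have qz : dot (q - x) (q - x) <= dot (z - x) (z - x).
  exact/dot_obtuse_center/qP.
have zx : `|z - x| <= w * r.
  rewrite /z addrAC subrr add0r normrZ ger0_norm// distrC.
  by rewrite ler_pM.
have -> : n.+1%:R * r * M / d * (v t - v s) = n.+1%:R * (w * r) by rewrite /w; ring.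
apply: (@le_trans _ _ (n.+1%:R * `|z - x|)); last by rewrite ler_wpM2l.
(* The squared Euclidean norm lies between the squared sup norm and [n] times it, and [n] is at most
   the square of [n.+1]. *)
rewrite -(@ler_pXn2r _ 2)// ?nnegrE ?mulr_ge0//.
apply: (le_trans (norm_sqr_le_dot _)); apply: (le_trans qz).
apply: (le_trans (ler_norm _)); apply: (le_trans (ler_norm_dot _ _)).
rewrite exprMn -mulrA -expr2 ler_wpM2r ?sqr_ge0// -natrX ler_nat.
by rewrite (leq_trans (leqnSn n))// leq_pmulr.
Qed.

(* The last clause replaces the differential inclusion: it makes no reference to
   derivatives and is stable under pointwise limits and concatenation. *)
Definition weak_solution (a c : R) (xa : 'rV[R]_n) (x : R -> 'rV[R]_n) : Prop :=
  [/\ x a = xa, forall t, a <= t <= c -> C t (x t),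
    exists2 K : R, 0 <= K & forall s t, a <= s -> s <= t -> t <= c ->
      `|x t - x s| <= K * (v t - v s) &
    forall s t z, a <= s -> s <= t -> t <= c ->
      (forall r, s <= r <= t -> C r z) ->
      dot (x t - z) (x t - z) <= dot (x s - z) (x s - z)].

End sweeping.

Section catching_up.
Context {R : realType} {n m : nat}.
Variables (u : 'I_m -> R -> 'rV[R]_n) (b : 'I_m -> R -> R) (v : R -> R).
Hypothesis ndv : {homo v : s t / s <= t}.
Hypothesis cv : continuous v.
Hypothesis uv : forall i, controlled_by v (u i).
Hypothesis bv : forall i, controlled_by (v : R -> R) (b i : R -> R^o).
Local Notation C := (polyhedron u b).
Hypothesis C0 : forall t, C t !=set0.
Variables (a c : R) (p xa : 'rV[R]_n) (d : R).
Hypotheses (d0 : 0 < d) (Cxa : C a xa).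
Hypothesis slater : forall t, a <= t <= c -> forall i, dot (u i t) p + d <= b i t.
Implicit Types (x y z : 'rV[R]_n) (s t : R) (N k j : nat).

Let Cp t : a <= t <= c -> C t p.
Proof. by move=> /slater H i; apply: le_trans (H i); rewrite lerDl ltW. Qed.

Lemma exists_projection_polyhedron : exists P : R -> 'rV[R]_n -> 'rV[R]_n,
  forall t x, C t (P t x) /\ forall z, C t z -> dot (x - P t x) (z - P t x) <= 0.
Proof.
have /choice[P PP] : forall tx : R * 'rV[R]_n, exists q,
    C tx.1 q /\ forall z, C tx.1 z -> dot (tx.2 - q) (z - q) <= 0.
  move=> [t x] /=; have [q Cq qP] := exists_projection x
    (@polyhedron_closed _ _ _ u b t) (C0 t) (@polyhedron_convex _ _ _ u b t).
  by exists q.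
by exists (fun t x => P (t, x)) => t x; exact: (PP (t, x)).
Qed.

Let P := sval (cid exists_projection_polyhedron).

Let CP t x : C t (P t x).
Proof. by have [] := svalP (cid exists_projection_polyhedron) t x. Qed.

Let obtuseP t x z : C t z -> dot (x - P t x) (z - P t x) <= 0.
Proof. by have [_] := svalP (cid exists_projection_polyhedron) t x; exact. Qed.

(** The grid is not adapted to [c]: estimates involving [p] are restricted to nodes at most [c]. *)
Definition node N k : R := a + k%:R / N.+1%:R.

Definition catchup N k : 'rV[R]_n :=
  iteri k (fun j y => P (node N j.+1) y) xa.

Let node0 N : node N 0 = a.
Proof. by rewrite /node mul0r addr0. Qed.

Let node_le N j k : (j <= k)%N -> node N j <= node N k.
Proof. by move=> jk; rewrite lerD2l ler_pM2r ?invr_gt0// ler_nat. Qed.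

Let node_ge N k : a <= node N k.
Proof. by rewrite -(node0 N) node_le. Qed.

Let catchup_mem N k : C (node N k) (catchup N k).
Proof. by case: k => [|k]; [rewrite node0|exact: CP]. Qed.

(** Every step projects on a set containing [z]. The index [j] is excluded because the projections
    in question start with the set at [j.+1]. *)
Lemma catchup_contraction N j k z : (j <= k)%N ->
  (forall i, (j < i <= k)%N -> C (node N i) z) ->
  dot (catchup N k - z) (catchup N k - z) <= dot (catchup N j - z) (catchup N j - z).
Proof.
elim: k => [|k ih]; first by rewrite leqn0 => /eqP ->.
rewrite leq_eqVlt => /predU1P[->//|]; rewrite ltnS => jk Cz.
apply: le_trans (ih jk _); last first.
  by move=> i /andP[ji ik]; apply: Cz; rewrite ji (leq_trans ik).
by apply: dot_obtuse_target; apply: obtuseP; apply: Cz; rewrite ltnS jk leqnn.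
Qed.

(** Since [s <= s ^+ 2 + 1], a bound on the squared distance to [p] gives this bound on the distance
    without a square root. *)
Let r := dot (xa - p) (xa - p) + 1.

Lemma catchup_bounded N k : node N k <= c -> `|catchup N k - p| <= r.
Proof.
move=> kc; have : dot (catchup N k - p) (catchup N k - p) <= dot (xa - p) (xa - p).
  apply: (@catchup_contraction N 0 k) => // i /andP[_ ik]; apply: Cp.
  by rewrite node_ge (le_trans (node_le N ik)).
move=> /(le_trans (norm_sqr_le_dot _)); rewrite /r.
by move: `|_| (dot _ _) => s t; have := sqr_ge0 (s - 1); nra.
Qed.

Let K := n.+1%:R * r * (n%:R * (r + `|p|) + 1) / d.

Let r0 : 0 <= r.
Proof. by rewrite addr_ge0// dot_ge0. Qed.

Let K0 : 0 <= K.
Proof.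
by rewrite /K divr_ge0 ?(ltW d0)// mulr_ge0 ?mulr_ge0// addr_ge0// mulr_ge0// addr_ge0.
Qed.

(** The iterates stay within [r] of [p], so one constant serves for all steps and the bounds
    telescope. *)
Lemma catchup_variation N j k : (j <= k)%N -> node N k <= c ->
  `|catchup N k - catchup N j| <= K * (v (node N k) - v (node N j)).
Proof.
elim: k => [|k ih]; first by rewrite leqn0 => /eqP -> _; rewrite !subrr normr0 mulr0.
rewrite leq_eqVlt => /predU1P[->//|]; rewrite ?subrr ?normr0 ?mulr0//.
rewrite ltnS => jk kc.
have kc' : node N k <= c := le_trans (node_le N (leqnSn k)) kc.
have := ih jk kc'.
have : `|catchup N k.+1 - catchup N k| <= K * (v (node N k.+1) - v (node N k)).
  apply: (projection_step ndv uv bv (node_le N (leqnSn k)) d0 (catchup_mem N k)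
    (catchup_bounded kc') _ (CP _ _)).
    by apply: slater; rewrite node_ge.
  by move=> z; exact: obtuseP.
have := ler_normD (catchup N k.+1 - catchup N k) (catchup N k - catchup N j).
rewrite subrKA; move: `|_| `|_| `|_| => x1 x2 x3; nra.
Qed.

(** For [a <= t], the index of the last node that does not exceed [t]. *)
Definition idx N t : nat := Num.truncn ((t - a) * N.+1%:R).

Lemma idx_le N t : a <= t -> node N (idx N t) <= t.
Proof.
move=> at_; rewrite /node -lerBrDl ler_pdivrMr//.
by rewrite truncn_le mulr_ge0// subr_ge0.
Qed.

Lemma idx_ge N t k : node N k <= t -> (k <= idx N t)%N.
Proof.
move=> kt; have at_ : a <= t := le_trans (node_ge N k) kt.
rewrite /idx truncn_ge_nat ?mulr_ge0 ?subr_ge0//.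
by rewrite -ler_pdivrMr// lerBrDl.
Qed.

Lemma idx_near N t : t - node N (idx N t) < N.+1%:R^-1.
Proof.
rewrite /node opprD addrA ltrBlDr -[X in _ < X + _]mul1r -mulrDl [1 + _]addrC natr1.
by rewrite ltr_pdivlMr// truncnS_gt.
Qed.

Lemma le_idx N s t : s <= t -> (idx N s <= idx N t)%N.
Proof. by move=> st; apply: le_truncn; rewrite ler_wpM2r// lerD2r. Qed.

Let idx_itv N t : a <= t <= c -> node N (idx N t) <= c.
Proof. by move=> /andP[at_ tc]; rewrite (le_trans _ tc)// idx_le. Qed.

Lemma cvg_v_idx t e : a <= t -> 0 < e ->
  \forall N \near \oo, v t - e < v (node N (idx N t)).
Proof.
move=> at_ e0; have vt : v t - e < v t by lra.
have /nbhs_ballP[h /= h0 hv] : \forall s \near t, v t - e < v s.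
  exact: (cvgr_gt (v t) (@cv t)) vt.
have := near_infty_natSinv_lt (PosNum h0); apply: filterS => N /= Nh.
apply: hv; rewrite /ball/= ger0_norm ?subr_ge0 ?idx_le//.
exact: lt_trans (idx_near N t) Nh.
Qed.

(** At each time the iterates stay in a compact ball, where every ultrafilter converges. A single
    ultrafilter finer than [\oo] thus serves all times at once, in place of a diagonal extraction of
    subsequences. *)
Lemma catchup_limit : exists (F : set_system nat) (x : R -> 'rV[R]_n),
  [/\ ProperFilter F, \oo `<=` F & forall t, a <= t <= c ->
    catchup N (idx N t) @[N --> F] --> x t].
Proof.
have [F [FU ooF]] := @ultraFilterLemma nat \oo _.
have FF : ProperFilter F by exact: ultra_proper.
have /choice[x xP] : forall t, exists q : 'rV[R]_n,
    (a <= t <= c -> catchup N (idx N t) @[N --> F] --> q) : Prop.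
  move=> t; have [atc|] := boolP (a <= t <= c); last by exists 0.
  have r1 : 0 < r + 1 by rewrite ltr_wpDl.
  have : compact (closed_ball p (r + 1)).
    apply: bounded_closed_compact; last exact: closed_ball_closed.
    rewrite closed_ballE//.
    exists (`|p| + (r + 1)); split; first exact: num_real.
    move=> M ltM q /= pq; rewrite (le_trans _ (ltW ltM))//.
    by rewrite -[q](subrK p) (le_trans (ler_normD _ _))// addrC lerD2l distrC.
  rewrite compact_ultra => /(_ _ (fmap_ultra (fun N => catchup N (idx N t)) FU)) [].
    apply: nearW => N; rewrite closed_ballE// /closed_ball_/= distrC.
    by rewrite (le_trans (catchup_bounded (idx_itv N atc)))// lerDl.
  by move=> q [_ Fq]; exists q.
by exists F, x.
Qed.

Lemma weak_solution_slater : a <= c ->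
  exists x : R -> 'rV[R]_n, weak_solution u b v a c xa x.
Proof.
move=> ac; have [F [x [FF ooF xP]]] := catchup_limit; exists x.
have sub_cvg s t z : a <= s <= c -> a <= t <= c ->
    dot (catchup N (idx N t) - z) (catchup N (idx N t) - z) -
      dot (catchup N (idx N s) - z) (catchup N (idx N s) - z) @[N --> F] -->
    dot (x t - z) (x t - z) - dot (x s - z) (x s - z).
  move=> asc atc; have xz r' : a <= r' <= c ->
      catchup N (idx N r') - z @[N --> F] --> x r' - z.
    by move=> arc; apply: (cvgB (xP _ arc)); exact: cvg_cst.
  by apply: cvgB; apply: cvg_dot; exact: xz.
split.
- have aac : a <= a <= c by rewrite lexx.
  have := xP _ aac; have -> : (fun N => catchup N (idx N a)) = cst xa.
    by apply/funext => N; rewrite /idx subrr mul0r truncn0.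
  by move=> /cvg_lim <-//; rewrite lim_cst.
(* The iterate lies in the polyhedron at the last node before [t]; its drift up to [t] tends to 0 by
   continuity of [v]. *)
- move=> t atc i; have at_ : a <= t by case/andP: atc.
  apply: (@cvg_le_near _ _ F _ (fun N => dot (u i t) (catchup N (idx N t)))).
    by apply: cvg_dot; [exact: cvg_cst|exact: xP].
  move=> e e0; pose M := n%:R * (r + `|p|) + 1.
  have M0 : 0 < M by rewrite ltr_wpDl// mulr_ge0// addr_ge0.
  apply: ooF; have := cvg_v_idx at_ (divr_gt0 e0 M0); apply: filterS => N vN.
  have MxM : n%:R * `|catchup N (idx N t)| + 1 <= M.
    rewrite lerD2r ler_wpM2l// -[X in `|X|](subrK p) (le_trans (ler_normD _ _))//.
    by rewrite lerD2r catchup_bounded// idx_itv.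
  have := polyhedron_drift ndv uv bv i (idx_le N at_) (catchup_mem N _) MxM.
  move=> /le_trans; apply; rewrite lerD2l mulrC -ler_pdivlMr//.
  by move: vN; move: (v t) (v _) (e / M) => *; lra.
- exists K => // s t as_ st tc.
  have asc : a <= s <= c by rewrite as_ (le_trans st).
  have atc : a <= t <= c by rewrite (le_trans as_ st).
  have at_ := le_trans as_ st.
  apply: (@cvg_le_near _ _ F _
    (fun N => `|catchup N (idx N t) - catchup N (idx N s)|)).
    by apply: cvg_norm; apply: cvgB; exact: xP.
  (* Only the node below [s] causes an error, since [v] at the node below [t] is at most [v t];
     [K + 1] is a positive divisor even if [K] is 0. *)
  move=> e e0; have K1 : 0 < K + 1 by rewrite ltr_wpDl.
  apply: ooF; have := cvg_v_idx as_ (divr_gt0 e0 K1); apply: filterS => N vN.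
  apply: (le_trans (catchup_variation (le_idx N st) (idx_itv N atc))).
  have vt : v (node N (idx N t)) <= v t by apply: ndv; exact: idx_le.
  have vs : (K + 1) * (v s - v (node N (idx N s))) <= e.
    by rewrite mulrC -ler_pdivlMr//; lra.
  have vs0 : v (node N (idx N s)) <= v s by apply: ndv; exact: idx_le.
  have := ler_wpM2l K0 vt; move: vs vs0; rewrite !mulrBr !mulrDl !mul1r.
  by move: (K * _) (K * _) (K * _) (K * _) => *; lra.
- move=> s t z as_ st tc Cz.
  have asc : a <= s <= c by rewrite as_ (le_trans st).
  have atc : a <= t <= c by rewrite (le_trans as_ st).
  rewrite -subr_le0; apply: (cvg_le_near FF (sub_cvg _ _ z asc atc)) => e e0.
  apply: nearW => N; rewrite add0r (le_trans _ (ltW e0))// subr_le0.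
  apply: catchup_contraction; first exact: le_idx.
  (* The nodes after index [idx N s] and up to [idx N t] lie between [s] and [t], where [z] is
     feasible. *)
  move=> i /andP[si it]; apply: Cz; apply/andP; split.
    by rewrite leNgt; apply/negP => /ltW/idx_ge; rewrite leqNgt si.
  by rewrite (le_trans (node_le N it))// idx_le// (le_trans as_).
Qed.

End catching_up.

(** * Strictly feasible points and global weak solutions *)

Section slater.
Context {R : realType} {n m : nat}.
Variables (u : 'I_m -> R -> 'rV[R]_n) (b : 'I_m -> R -> R).
Implicit Types (x p : 'rV[R]_n) (t : R).

Lemma dotmxE x (y : 'rV[R]_n) : dot x y = (x *m y^T) ord0 ord0.
Proof. by rewrite mxE; apply: eq_bigr => j _; rewrite mxE. Qed.

(** The matrix whose rows are the vectors of [s] has a right inverse, which is applied to the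
    constant column [-1]. *)
Lemma free_dot_surj (s : seq 'rV[R]_n) : free s ->
  exists d, forall y, y \in s -> dot y d = -1.
Proof.
move=> /(@freeP _ _ _ (in_tuple s)) fs.
pose M : 'M[R]_(size s, n) := \matrix_(i < size s) s`_i.
have /row_freeP[B MB] : row_free M.
  apply: inj_row_free => w wM; apply/rowP => i; rewrite mxE.
  apply: (fs (fun i => w ord0 i)); rewrite -[RHS]wM mulmx_sum_row.
  by apply: eq_bigr => j _; rewrite rowK.
exists (B *m const_mx (-1))^T => y ys.
have ysz : (index y s < size s)%N by rewrite index_mem.
have -> : y = row (Ordinal ysz) M by rewrite rowK nth_index.
by rewrite dotmxE trmxK -row_mul mulmxA MB mul1mx !mxE.
Qed.

(** Along a direction [d] in which all active constraints decrease, a small enough step also keeps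
    the finitely many inactive ones strict. *)
Lemma slater_point t x : polyhedron u b t x ->
  free [seq u i t | i <- enum (active u b t x)] ->
  exists p, forall i, dot (u i t) p < b i t.
Proof.
move=> Cx /free_dot_surj[d dP].
have : \forall e \near (0:R)^'+, forall i, dot (u i t) (x + e *: d) < b i t.
  apply: filter_forall => i.
  have [ai|ai] := boolP (i \in active u b t x).
    near=> e; rewrite dotDr dotZr dP ?mulrN1; last first.
      by apply: map_f; rewrite mem_enum.
    have -> : dot (u i t) x = b i t by move: ai; rewrite inE => /eqP.
    by rewrite gtrDl oppr_lt0; near: e; exact: nbhs_right_gt.
  have xi : dot (u i t) x < b i t.
    by rewrite lt_neqAle (Cx i) andbT; move: ai; rewrite inE.
  have D0 : 0 < `|dot (u i t) d| + 1 by rewrite ltr_wpDl.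
  near=> e; rewrite dotDr dotZr.
  have e0 : 0 < e by near: e; exact: nbhs_right_gt.
  have : e < (b i t - dot (u i t) x) / (`|dot (u i t) d| + 1).
    by near: e; apply: nbhs_right_lt; rewrite divr_gt0// subr_gt0.
  rewrite ltr_pdivlMr// mulrDr mulr1.
  have := ler_wpM2l (ltW e0) (ler_norm (dot (u i t) d)).
  by move: (e * _) (e * _) => *; lra.
by move=> /filter_ex[e eP]; exists (x + e *: d).
Unshelve. all: by end_near. Qed.

End slater.

Section global.
Context {R : realType} {n m : nat}.
Variables (u : 'I_m -> R -> 'rV[R]_n) (b : 'I_m -> R -> R) (v : R -> R).
Hypothesis ndv : {homo v : s t / s <= t}.
Hypothesis cv : continuous v.
Hypothesis uv : forall i, controlled_by v (u i).
Hypothesis bv : forall i, controlled_by (v : R -> R) (b i : R -> R^o).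
Hypothesis slater : forall t, exists p, forall i, dot (u i t) p < b i t.
Local Notation C := (polyhedron u b).
Implicit Types (s t : R).

Lemma controlled_by_continuous (V : normedModType R) (f : R -> V) :
  controlled_by v f -> continuous f.
Proof.
move=> fv t; apply/cvgrPdist_lt => e e0; near=> s.
have vst : `|v t - v s| < e by near: s; apply: cvgr_dist_lt => //; exact: cv.
apply: le_lt_trans vst; have [st|/ltW ts] := leP s t.
  by rewrite (le_trans (fv _ _ st))// ler_norm.
by rewrite distrC (le_trans (fv _ _ ts))// distrC ler_norm.
Unshelve. all: by end_near. Qed.

Lemma slater_near t (p : 'rV[R]_n) (d : R) : (forall i, dot (u i t) p + d < b i t) ->
  \forall s \near t, forall i, dot (u i s) p + d < b i s.
Proof.
move=> pd; suff H i : \forall s \near t, dot (u i s) p + d < b i s.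
  exact: (@filter_forall _ _ _ _ (nbhs_filter t) H).
have cg : (fun s => b i s - dot (u i s) p) @ t --> b i t - dot (u i t) p.
  have cb : (b i s : R) @[s --> t] --> b i t.
    exact: (controlled_by_continuous (bv i)).
  have cu : u i s @[s --> t] --> u i t by exact: (controlled_by_continuous (uv i)).
  exact: (cvgB cb (cvg_dot cu (cvg_cst p))).
have dt : d < b i t - dot (u i t) p by rewrite ltrBrDl pd.
by near=> s; rewrite -ltrBrDl; near: s; exact: (cvgr_gt _ cg _ dt).
Unshelve. all: by end_near. Qed.

Lemma slater_locally t : exists p : 'rV[R]_n, exists2 d, 0 < d &
  exists2 h, 0 < h & forall s, t - h < s < t + h ->
    forall i, dot (u i s) p + d <= b i s.
Proof.
have [p pt] := slater t; exists p.
have : \forall d \near (0:R)^'+, forall i, dot (u i t) p + d < b i t.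
  apply: filter_forall => i; near=> d; rewrite -ltrBrDl.
  by near: d; apply: nbhs_right_lt; rewrite subr_gt0.
move=> /(filterI (nbhs_right_gt _))/filter_ex[d [d0 pd]]; exists d => //.
have /nbhs_ballP[h /= h0 H] := slater_near pd; exists h => // s sh i.
by apply/ltW/H; rewrite /ball/= ltr_distlC.
Unshelve. all: by end_near. Qed.

(** Each estimate over an interval containing [c] splits at [c], where the two curves agree. *)
Lemma weak_solution_cat (a c e : R) xa x y : a <= c -> c <= e ->
  weak_solution u b v a c xa x -> weak_solution u b v c e (x c) y ->
  weak_solution u b v a e xa (fun t => if t <= c then x t else y t).
Proof.
move=> ac ce [xa_ Cx [K K0 xK] xz] [yc Cy [L L0 yL] yz].
split.
- by rewrite ac.
- move=> t /andP[at_ te]; case: ifPn => [tc|]; first by apply: Cx; rewrite at_.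
  by rewrite -ltNge => /ltW ct; apply: Cy; rewrite ct.
- exists (K + L); first exact: addr_ge0.
  move=> s t as_ st te; have vst : 0 <= v t - v s by rewrite subr_ge0 ndv.
  case: ifPn => [tc|]; [rewrite (le_trans st tc)|rewrite -ltNge => /ltW ct].
    by rewrite (le_trans (xK _ _ as_ st tc))// ler_wpM2r// lerDl.
  case: ifPn => [sc|]; last rewrite -ltNge => /ltW cs.
    have := ler_normD (y t - y c) (x c - x s); rewrite {1}yc subrKA => /le_trans; apply.
    have := xK _ _ as_ sc (lexx c); have := yL _ _ (lexx c) ct te.
    have := ler_wpM2l K0 (ndv ct); have := ler_wpM2l L0 (ndv sc).
    by rewrite !mulrBr !mulrDl; lra.
  by rewrite (le_trans (yL _ _ cs st te))// ler_wpM2r// lerDr.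
- move=> s t z as_ st te Cz.
  case: ifPn => [tc|]; [rewrite (le_trans st tc)|rewrite -ltNge => /ltW ct].
    exact: xz.
  case: ifPn => [sc|]; last by rewrite -ltNge => /ltW cs; exact: yz.
  apply: (@le_trans _ _ (dot (y c - z) (y c - z))).
    apply: yz => // r /andP[cr rt]; apply: Cz.
    by rewrite rt (le_trans sc).
  rewrite yc; apply: xz => // r /andP[sr rc]; apply: Cz.
  by rewrite sr (le_trans rc).
Qed.

Lemma exists_weak_solution (a c : R) xa : a <= c -> C a xa ->
  exists x, weak_solution u b v a c xa x.
Proof.
have C0 t : C t !=set0.
  by have [p pt] := slater t; exists p => i; exact/ltW/pt.
(* Quantifying over the initial point makes the property composable: the second piece starts where
   the first one ends. *)
pose Q s t := forall xs, C s xs -> exists x, weak_solution u b v s t xs x.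
move=> ac; suff : Q a c by exact.
apply: (cousin ac) => [s t r st tr Qst Qtr xs Cs|t].
  have [x xP] := Qst _ Cs; have [_ Cx _ _] := xP.
  have [|y yP] := Qtr (x t); first by apply: Cx; rewrite lexx st.
  by exists (fun r => if r <= t then x r else y r); exact: weak_solution_cat xP yP.
have [p [d d0 [h h0 H]]] := slater_locally t; exists h => // s r hs st tr rh xs Cs.
apply: (weak_solution_slater ndv cv uv bv C0 d0 Cs (p := p)) => [q /andP[sq qr]|].
  by apply: H; rewrite (lt_le_trans hs)// (le_lt_trans qr).
exact: le_trans tr.
Qed.

End global.

(** * Derivatives and uniqueness *)

(** Freezing time outside [[a, c]] can only shrink increments; this extends the control of a
    solution from the interval to the line. *)
Lemma le_increment_clip (R : realType) (a c : R) (v : R -> R) (s t : R) :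
  a <= c -> {homo v : s t / s <= t} -> s <= t ->
  v (clip a c t) - v (clip a c s) <= v t - v s.
Proof.
move=> ac ndv st.
have clipl r : r <= a -> clip a c r = a.
  by move=> ra; rewrite /clip (min_idPl _) ?(le_trans ra)// (max_idPl ra).
have clipr r : c <= r -> clip a c r = c.
  by move=> cr; rewrite /clip (min_idPr cr) (max_idPr ac).
have [ta|/ltW at_] := leP t a.
  by rewrite !clipl ?subrr ?subr_ge0 ?ndv// (le_trans st).
have [sc|/ltW cs] := leP s c; last first.
  by rewrite !clipr ?subrr ?subr_ge0 ?ndv// (le_trans cs).
apply: lerB.
  have [tc|/ltW ct] := leP t c; first by rewrite clip_id// at_.
  by rewrite clipr// ndv.
have [sa|/ltW as_] := leP s a; first by rewrite clipl// ndv.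
by rewrite clip_id// as_.
Qed.

Lemma dot_subsqr (R : realType) n (x y : 'rV[R]_n) :
  dot x x - dot y y = dot (x - y) (x + y).
Proof. by rewrite !dotE (dotC y x); lra. Qed.

Section derivative.
Context {R : realType}.

Lemma cvg_derive1 (V : normedModType R) (f : R -> V) (t : R) : derivable f t 1 ->
  h^-1 *: (f (h + t) - f t) @[h --> 0^'] --> derive1 f t.
Proof.
move=> df; rewrite derive1E /derive.
have -> : (fun h => h^-1 *: (f (h + t) - f t)) =
          (fun h => h^-1 *: ((f \o shift t) (h *: 1) - f t)).
  by apply/funext => h; rewrite /= [_ *: 1]mulr1.
exact: df.
Qed.

Lemma derivable_cvg_shift (V : normedModType R) (f : R -> V) (t : R) :
  derivable f t 1 -> f (h + t) @[h --> 0^'] --> f t.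
Proof.
move=> /derivable1_diffP/differentiable_continuous ft.
suff H : h + t @[h --> (0 : R)^'] --> t by exact: (cvg_comp _ _ H ft).
have cid : h @[h --> (0 : R)^'] --> (0 : R) by exact: nbhs_dnbhs.
have ct : t @[h --> (0 : R)^'] --> t by exact: cvg_cst.
have H : h + t @[h --> (0 : R)^'] --> 0 + t by exact: (cvgD cid ct).
by rewrite -{2}(add0r t).
Qed.

Lemma at_right_dnbhs (a : R) : a^'+ `=>` a^'.
Proof.
move=> A /=; rewrite /dnbhs /at_right /within /=; apply: filterS => x Ax ax.
by apply: Ax; rewrite /= gt_eqF.
Qed.

End derivative.

Section normal_derivative.
Context {R : realType} {n m : nat}.
Variables (u : 'I_m -> R -> 'rV[R]_n) (b : 'I_m -> R -> R) (v : R -> R).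
Hypothesis cv : continuous v.
Hypothesis uv : forall i, controlled_by v (u i).
Hypothesis bv : forall i, controlled_by (v : R -> R) (b i : R -> R^o).
Hypothesis slater : forall t, exists p, forall i, dot (u i t) p < b i t.
Local Notation C := (polyhedron u b).

(** A point [z] strictly feasible at [t] stays feasible for a short time, so the distance from [x]
    to [z] does not increase just after [t]; difference quotients from the right give the inequality
    for such [z]. *)
Lemma weak_solution_normal (a c : R) xa (x : R -> 'rV[R]_n) t :
  weak_solution u b v a c xa x -> a < t < c -> derivable x t 1 ->
  normal_cone (C t) (x t) (- derive1 x t).
Proof.
move=> [_ Cx _ xz] /andP[at_ tc] dx.
have Cxt : C t (x t) by apply: Cx; rewrite !ltW.
have strict (z : 'rV[R]_n) : (forall i, dot (u i t) z < b i t) ->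
    dot (derive1 x t) (x t - z) <= 0.
  move=> zt; have zt0 i : dot (u i t) z + 0 < b i t by rewrite addr0.
  have /nbhs_ballP[e /= e0 He] := slater_near cv uv bv zt0.
  have Cz s : t <= s < t + e -> C s z.
    move=> /andP[ts se] i; have := He s; rewrite /ball/= ltr_distlC.
    rewrite se (lt_le_trans _ ts) ?ltrBlDr ?ltrDl// => /(_ isT i).
    by rewrite addr0 => /ltW.
  have cxr : h^-1 *: (x (h + t) - x t) @[h --> 0^'+] --> derive1 x t.
    exact: (cvg_trans (cvg_app _ (@at_right_dnbhs _ 0)) (cvg_derive1 dx)).
  have cz : x t - z @[h --> (0 : R)^'+] --> x t - z by exact: cvg_cst.
  apply: (cvg_le_near _ (cvg_dot cxr cz)) => r r0; rewrite add0r.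
  near=> h.
  have h0 : 0 < h by near: h; exact: nbhs_right_gt.
  have he : h < e by near: h; exact: nbhs_right_lt.
  have hc : h < c - t by near: h; apply: nbhs_right_lt; rewrite subr_gt0.
  rewrite (le_trans _ (ltW r0))// dotZl pmulr_rle0 ?invr_gt0//.
  have tht : t <= h + t by lra.
  have : dot (x (h + t) - z) (x (h + t) - z) <= dot (x t - z) (x t - z).
    apply: xz; [exact: ltW|exact: tht|lra|].
    by move=> s /andP[ts sh]; apply: Cz; rewrite ts/=; lra.
  have := dot_ge0 (x (h + t) - x t); rewrite !dotE.
  by rewrite (dotC z (x t)) (dotC z (x (h + t))) (dotC (x t) (x (h + t))); lra.
split=> // z Cz; rewrite dotNl -dotNr opprB.
have [p pt] := slater t.
(* By density of the strictly feasible points [z + l *: (p - z)]. *)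
set D := dot _ (x t - z); set E := dot (derive1 x t) (p - z).
rewrite leNgt; apply/negP => D0.
have DE : 0 < D + `|E| + 1 by rewrite addr_gt0// ltr_wpDr.
(* For this [l], [D - l * E] is at least [l * (D + 1)], which is positive and contradicts the
   inequality for strictly feasible points. *)
pose l := D / (D + `|E| + 1).
have l0 : 0 < l by rewrite divr_gt0.
have lE : l * (D + `|E| + 1) = D by rewrite divfK// gt_eqF.
have l1 : l <= 1 by rewrite ler_pdivrMr// mul1r -addrA lerDl addr_ge0.
have := strict (z + l *: (p - z)).
have -> : dot (derive1 x t) (x t - (z + l *: (p - z))) = D - l * E.
  by rewrite opprD addrA dotBr dotZr.
have lD0 := mulr_gt0 l0 D0.
have := ler_wpM2l (ltW l0) (ler_norm E); move: lE; rewrite !mulrDr mulr1 => lE lEE.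
move=> H; suff : D - l * E <= 0 by lra.
apply: H => i; rewrite dotDr dotZr dotBr; have := Cz i; have := pt i.
by move: (dot _ p) (dot _ z) (b i t) => pi zi bi; nra.
Unshelve. all: by end_near. Qed.

Lemma weak_solution_clip (a c : R) xa (x : R -> 'rV[R]_n) : a <= c ->
  weak_solution u b v a c xa x -> weak_solution u b v a c xa (x \o clip a c).
Proof.
move=> ac [xa_ Cx [K K0 xK] xz]; split => /=.
- by rewrite clip_id// lexx.
- by move=> t atc; rewrite clip_id//; exact: Cx.
- exists K => // s t as_ st tc; rewrite !clip_id ?xK//.
    by rewrite as_ (le_trans st).
  by rewrite (le_trans as_ st).
- move=> s t z as_ st tc Cz; rewrite !clip_id ?xz//.
    by rewrite as_ (le_trans st).
  by rewrite (le_trans as_ st).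
Qed.

End normal_derivative.

Section uniqueness.
Context {R : realType} {n : nat}.
Notation mu := (@lebesgue_measure R).

Lemma ae_neq (a : R) : {ae mu, forall t, t != a}.
Proof.
exists [set a]; split => //; first exact: lebesgue_measure_set1.
by move=> t /= /negP; rewrite negbK => /eqP.
Qed.

Lemma control_bounded (v : R -> R) (V : normedModType R) (f : R -> V) :
  control v -> controlled_by v f -> exists M, forall t, `|f t| <= M.
Proof.
move=> [ndv _ [C vC]] fv; exists (C + `|f 0|) => t.
rewrite -[f t](subrK (f 0)) (le_trans (ler_normD _ _))// lerD2r.
have [t0|/ltW t0] := leP 0 t; first by rewrite (le_trans (fv _ _ t0)).
by rewrite distrC (le_trans (fv _ _ t0)).
Qed.

Lemma monotone_solution_unique (T : R) (C : R -> set 'rV[R]_n) x0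
    (x y : R -> 'rV[R]_n) : 0 <= T ->
  sweeping_solution T C x0 x -> sweeping_solution T C x0 y ->
  forall t, t \in `[0, T] -> y t = x t.
Proof.
move=> T0 [acx xN x00] [acy yN y00] t0 t0T.
have [vx cvx xv] := abs_continuous_rV_control T0 acx.
have [vy cvy yv] := abs_continuous_rV_control T0 acy.
pose z t := x t - y t; pose Z := z \o clip 0 T.
pose w t := dot (Z t) (Z t).
have cv : control (vx \+ vy) := controlD cvx cvy.
have Zv : controlled_by (vx \+ vy) Z.
  move=> s t st; rewrite /Z/= /z.
  have -> : x (clip 0 T t) - y (clip 0 T t) - (x (clip 0 T s) - y (clip 0 T s)) =
    (x (clip 0 T t) - x (clip 0 T s)) - (y (clip 0 T t) - y (clip 0 T s)).
    by rewrite !opprB addrACA [RHS]addrACA [- _ + _]addrC.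
  apply: (le_trans (ler_normB _ _)).
  by have := xv _ _ st; have := yv _ _ st; rewrite /=; lra.
have [M ZM] := control_bounded cv Zv.
have M0 : 0 <= M := le_trans (normr_ge0 _) (ZM 0).
(* The increment of [w] is the inner product of [Z t - Z s] and [Z t + Z s], and the latter has norm
   at most [M + M]. *)
pose K := n%:R * (M + M).
have K0 : 0 <= K by rewrite mulr_ge0// addr_ge0.
have wv : controlled_by (fun t => K * (vx \+ vy) t) (w : R -> R^o).
  move=> s t st; have -> : w t - w s = dot (Z t - Z s) (Z t + Z s).
    exact: dot_subsqr.
  apply: (le_trans (ler_norm_dot _ _)); rewrite -mulrBr -mulrA [_ * `|_ + _|]mulrC.
  rewrite mulrA ler_pM ?mulr_ge0//; last exact: Zv.
  by rewrite ler_wpM2l// (le_trans (ler_normD _ _))// lerD.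
move: (t0T); rewrite in_itv/= => /andP[t00 t01].
have wle : w t0 <= w 0.
  apply: (controlled_by_nonincreasing (controlZ K0 cv) wv t00).
  have aeF := ae_filter_ringOfSetsType mu.
  (* Excluding [T] leaves interior times, near which [clip] is the identity, so that [w] has the
     derivative of the unclipped squared distance. *)
  move: (ae_neq T) xN yN; apply: filterS3 => t tT xN yN.
  rewrite in_itv/= => /andP[t_gt0 tt0].
  have tltT : t < T by rewrite lt_neqAle tT (le_trans tt0).
  have tin : t \in `[0, T] by rewrite in_itv/= !ltW.
  have [dx [vx' [Cx xn] /esym xE]] := xN tin.
  have [dy [vy' [Cy yn] /esym yE]] := yN tin.
  have dz : derivable z t 1 by exact: derivableB.
  have zE : derive1 z t = derive1 x t - derive1 y t.
    by rewrite !derive1E -(deriveB dx dy).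
  have cw : (h^-1 *: (w (h + t) - w t) : R^o) @[h --> 0^'] -->
      (dot (derive1 z t) (z t + z t) : R^o).
    have cst_z : z t @[h --> (0 : R)^'] --> z t by exact: cvg_cst.
    have ez : z (h + t) + z t @[h --> 0^'] --> z t + z t.
      exact: (cvgD (derivable_cvg_shift dz) cst_z).
    have cz : dot (h^-1 *: (z (h + t) - z t)) (z (h + t) + z t) @[h --> 0^'] -->
        dot (derive1 z t) (z t + z t).
      exact: (cvg_dot (cvg_derive1 dz) ez).
    refine (cvg_trans _ cz); apply: near_eq_cvg; near=> h.
    have ht : 0 <= h + t <= T.
      have : `|h| < Num.min t (T - t).
        by near: h; apply: dnbhs0_lt; rewrite lt_min t_gt0 subr_gt0.
      by rewrite lt_min => /andP[]; rewrite !ltr_norml => /andP[? ?] /andP[? ?]; lra.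
    have tT' : 0 <= t <= T by rewrite !ltW.
    rewrite /w /Z/= !clip_id// dotZl; congr (_ * _).
    exact/esym/dot_subsqr.
  rewrite [leLHS](_ : _ = dot (derive1 z t) (z t + z t)); last exact: (cvg_lim _ cw).
  (* Monotonicity of the normal cones: each normal vector is tested at the other solution. *)
  have := xn _ Cy; have := yn _ Cx.
  rewrite zE xE yE /z !dotE; lra.
have wt0 : dot (z t0) (z t0) = 0.
  apply/eqP; rewrite eq_le dot_ge0 andbT.
  move: wle; rewrite /w /Z/= !clip_id ?lexx ?t00// => /le_trans; apply.
  by rewrite /z x00 y00 subrr /dot big1// => j _; rewrite mxE mul0r.
apply/esym/eqP; rewrite -subr_eq0 -normr_eq0 -/(z t0) -sqrf_eq0 eq_le sqr_ge0 andbT.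
by rewrite -wt0 norm_sqr_le_dot.
Unshelve. all: by end_near. Qed.

End uniqueness.

Theorem theorem2p2 (R : realType) (n m : nat) (T : R) (hT : 0 < T)
    (u : 'I_m -> R -> 'rV[R]_n) (b : 'I_m -> R -> R)
    (hu : forall i, abs_continuous 0 T (u i))
    (hb : forall i, abs_continuous 0 T (b i))
    (hC : forall t, t \in `[0, T] -> polyhedron u b t !=set0)
    (hLI : forall t, t \in `[0, T] -> forall x, polyhedron u b t x ->
       free [seq u i t | i <- enum (active u b t x)])
    (x0 : 'rV[R]_n) (hx0 : polyhedron u b 0 x0) :
  exists2 x : R -> 'rV[R]_n,
    sweeping_solution T (polyhedron u b) x0 x &
    forall y : R -> 'rV[R]_n, sweeping_solution T (polyhedron u b) x0 y ->
      forall t, t \in `[0, T] -> y t = x t.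
Proof.
have T0 := ltW hT.
suff [x xS] : exists x, sweeping_solution T (polyhedron u b) x0 x.
  by exists x => // y yS; exact: monotone_solution_unique xS yS.
(* With the data frozen outside [[0, T]], nonemptiness and linear independence provide strictly
   feasible points at all real times. *)
pose U i := u i \o clip 0 T; pose B i := b i \o clip 0 T.
have clipT t : clip 0 T t \in `[0, T] by rewrite in_itv/= clip_ge clip_le.
have /choice[vu vuP] i : exists v, control v /\ controlled_by v (U i).
  by have [v cv uv] := abs_continuous_rV_control T0 (hu i); exists v.
have /choice[vb vbP] i : exists v, control v /\ controlled_by v (B i : R -> R^o).
  by have [v cv bv] := abs_continuous_control T0 (hb i); exists v.
pose su t := \sum_i vu i t; pose sb t := \sum_i vb i t.
have csu : control su by apply: control_sum => i; case: (vuP i).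
have csb : control sb by apply: control_sum => i; case: (vbP i).
pose v := su \+ sb; have cv : control v := controlD csu csb.
have [ndv acv _] := cv.
have contv : continuous v by exact: (ac_line_continuous acv).
have Uv i : controlled_by v (U i).
  apply: controlled_by_widen; first by case: csb.
  by apply: (controlled_by_sum (V := fun=> 'rV[R]_n)) => j; case: (vuP j).
have Bv i : controlled_by v (B i : R -> R^o).
  rewrite (_ : v = sb \+ su); last by apply/funext => t; rewrite /v/= addrC.
  apply: controlled_by_widen; first by case: csu.
  by apply: (controlled_by_sum (V := fun=> R^o)) => j; case: (vbP j).
have slater t : exists p, forall i, dot (U i t) p < B i t.
  have [x Cx] := hC _ (clipT t).
  by have [p pP] := slater_point Cx (hLI _ (clipT t) _ Cx); exists p.
have CE t : 0 <= t <= T -> polyhedron U B t = polyhedron u b t.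
  by move=> tT; rewrite /polyhedron /U /B/= clip_id.
have [|x /(weak_solution_clip T0)] :=
    exists_weak_solution ndv contv Uv Bv slater (xa := x0) T0.
  by rewrite CE// lexx.
set X := x \o clip 0 T => wX; exists X.
have [X0 _ [K K0 XK] _] := wX.
have cKv := controlZ K0 cv.
have XKv : controlled_by (fun t => K * v t) X.
  move=> s t st; have := XK (clip 0 T s) (clip 0 T t).
  rewrite /X/= !(@clip_id _ 0 T (clip _ _ _)) ?clip_ge ?clip_le// => XKc.
  rewrite (le_trans (XKc _ _ _)) ?clip_ge ?clip_le ?le_clip// -mulrBr.
  by rewrite ler_wpM2l// le_increment_clip.
have aeF := ae_filter_ringOfSetsType (@lebesgue_measure R).
split => //.
  apply: ac_line_abs_continuous; have [_ acK _] := cKv.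
  apply: (ac_line_dom (K := 1) _ acK) => s t st; rewrite mul1r; exact: XKv.
have dX := controlled_by_ae_derivable_mx cKv XKv.
(* The normal inclusion was obtained at interior times only; the two endpoints form a null set. *)
have ae0 := ae_neq (0 : R); have aeT := ae_neq T.
move: dX ae0 aeT; apply: filterS3 => t dXt t0 tT.
rewrite in_itv/= => tin; split => //; exists (- derive1 X t); last by rewrite opprK.
rewrite -CE//; apply: (weak_solution_normal contv Uv Bv slater wX) => //.
by move: tin => /andP[t0' tT']; rewrite !lt_neqAle tT tT' eq_sym t0 t0'.
Qed.
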